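(* The random walk on any non-degenerate T-graph is recurrent.
   Context: A T-graph $T\subset\mathbb C$ is a planar graph formed by segments (images of black faces of the triangular lattice $\mathcal H^\dagger$ dual to the hexagonal lattice) and triangular faces similar to a fixed triangle $\Delta$ with angles $\pi p_a,\pi p_b,\pi p_c$ ($p_\bullet\in(0,1)$, sum $1$), obtained as the image of $\mathcal H^\dagger$ under a map $\psi=\psi_{\lambda\Delta}$ depending on $\Delta$ and a unit complex number $\lambda$. It is non-degenerate if no triangle is degenerate to a point and every vertex of $T$ lies in exactly three segments, being an endpoint of two and in the interior of exactly one. Random walk on $T$: the continuous-time Markov process on vertices of $T$ which, from a vertex $v$, with $v^+,v^-$ the endpoints of the unique segment containing $v$ in its interior, jumps to $v^\pm$ at rate $1/|v^\pm-v|$. Recurrent means that the walk started from any vertex returns to it almost surely. *)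

(* Defs.v *)
From Stdlib Require Import Reals Lra ZArith List ClassicalEpsilon.
Import ListNotations.
Open Scope R_scope.

Record Cx := mkC { Re : R; Im : R }.
Definition C0 : Cx := mkC 0 0.
Definition C1 : Cx := mkC 1 0.
Definition Cadd (z w : Cx) : Cx := mkC (Re z + Re w) (Im z + Im w).
Definition Cneg (z : Cx) : Cx := mkC (- Re z) (- Im z).
Definition Csub (z w : Cx) : Cx := Cadd z (Cneg w).
Definition Cmul (z w : Cx) : Cx :=
  mkC (Re z * Re w - Im z * Im w) (Re z * Im w + Im z * Re w).
Definition Cscal (r : R) (z : Cx) : Cx := mkC (r * Re z) (r * Im z).
Definition Cconj (z : Cx) : Cx := mkC (Re z) (- Im z).
Definition Cnorm2 (z : Cx) : R := Re z * Re z + Im z * Im z.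
Definition Cabs (z : Cx) : R := sqrt (Cnorm2 z).
Definition Cinv (z : Cx) : Cx := Cscal (/ Cnorm2 z) (Cconj z).
Definition Cexpi (t : R) : Cx := mkC (cos t) (sin t).
Fixpoint Cpow (z : Cx) (n : nat) : Cx :=
  match n with O => C1 | S k => Cmul z (Cpow z k) end.
Definition Cpowz (z : Cx) (k : Z) : Cx :=
  if (0 <=? k)%Z then Cpow z (Z.to_nat k) else Cpow (Cinv z) (Z.to_nat (- k)).
Definition Cdir2 (d : Cx) : Cx := Cscal (/ Cnorm2 d) (Cmul d d).

(** * The triangular lattice H^dagger (dual of the hexagonal lattice).
    Vertices are Z x Z; vertex (m,n) sits at m*A + n*B.
    White faces ("up" triangles) U(m,n) = {(m,n),(m+1,n),(m,n+1)};
    black faces ("down" triangles) D(i,j) = {(i+1,j),(i,j+1),(i+1,j+1)}. *)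
Definition V := (Z * Z)%type.

(** Reference triangle Delta = (0, A, B), counterclockwise, with angles
    pi*pa at 0, pi*pb at A, pi*pc at B. *)
Definition DeltaA : Cx := C1.
Definition DeltaB (pa pb pc : R) : Cx :=
  Cscal (sin (PI * pb) / sin (PI * pc)) (Cexpi (PI * pa)).

(** Rotation parts of the origami (folding) map of the linear embedding:
    on the white face U(m,n) the origami map is z |-> eta m n * z + const,
    obtained by successive reflections across the edges. *)
Definition rho1 (pa pb pc : R) : Cx :=
  Cmul (Cdir2 (Csub (DeltaB pa pb pc) DeltaA)) (Cconj (Cdir2 (DeltaB pa pb pc))).
Definition rho2 (pa pb pc : R) : Cx :=
  Cmul (Cdir2 (Csub (DeltaB pa pb pc) DeltaA)) (Cconj (Cdir2 DeltaA)).
Definition eta (pa pb pc : R) (m n : Z) : Cx :=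
  Cmul (Cpowz (rho1 pa pb pc) m) (Cpowz (rho2 pa pb pc) n).

(** psi = T + lam * O  (T = linear embedding, O = origami map), determined up
    to translation by its increments along the edges of white faces. *)
Definition is_psi (pa pb pc : R) (lam : Cx) (psi : V -> Cx) : Prop :=
  forall m n : Z,
    Csub (psi ((m + 1)%Z, n)) (psi (m, n))
      = Cmul (Cadd C1 (Cmul lam (eta pa pb pc m n))) DeltaA /\
    Csub (psi (m, (n + 1)%Z)) (psi (m, n))
      = Cmul (Cadd C1 (Cmul lam (eta pa pb pc m n))) (DeltaB pa pb pc).

Definition in_hull3 (p a b c : Cx) : Prop :=
  exists t1 t2 t3 : R, 0 <= t1 /\ 0 <= t2 /\ 0 <= t3 /\ t1 + t2 + t3 = 1 /\
    p = Cadd (Cscal t1 a) (Cadd (Cscal t2 b) (Cscal t3 c)).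

Definition strictly_between (p a b : Cx) : Prop :=
  a <> b /\ exists t : R, 0 < t < 1 /\ p = Cadd (Cscal (1 - t) a) (Cscal t b).

Definition in_black (v : V) (i j : Z) : Prop :=
  v = ((i + 1)%Z, j) \/ v = (i, (j + 1)%Z) \/ v = ((i + 1)%Z, (j + 1)%Z).

(** For a vertex v=(m,n), the three black faces containing v, each given by
    the pair of its two other vertices: D(m-1,n), D(m,n-1), D(m-1,n-1). *)
Definition inc_black (v : V) : list (V * V) :=
  let (m, n) := v in
  [ (((m - 1)%Z, (n + 1)%Z), (m, (n + 1)%Z));
    (((m + 1)%Z, (n - 1)%Z), ((m + 1)%Z, n));
    ((m, (n - 1)%Z), ((m - 1)%Z, n)) ].

(** psi(v) lies in the interior of the segment psi(D) for the black face D
    (given by the other two vertices (a,b)). *)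
Definition interior_of (psi : V -> Cx) (v : V) (ab : V * V) : Prop :=
  strictly_between (psi v) (psi (fst ab)) (psi (snd ab)).

Definition exactly_one3 (P Q S : Prop) : Prop :=
  (P /\ ~ Q /\ ~ S) \/ (~ P /\ Q /\ ~ S) \/ (~ P /\ ~ Q /\ S).

(** Non-degeneracy: no white triangle is degenerate to a point, and every
    vertex of T lies in exactly three segments (those of the three black faces
    containing it), being in the interior of exactly one of them (and hence an
    endpoint of the other two). *)
Definition nondegenerate (psi : V -> Cx) : Prop :=
  (forall m n : Z,
      ~ (psi (m, n) = psi ((m + 1)%Z, n) /\ psi (m, n) = psi (m, (n + 1)%Z))) /\
  (forall (v : V) (i j : Z),
      in_hull3 (psi v) (psi ((i + 1)%Z, j)) (psi (i, (j + 1)%Z))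
               (psi ((i + 1)%Z, (j + 1)%Z)) -> in_black v i j) /\
  (forall v : V,
      match inc_black v with
      | [f1; f2; f3] =>
          exactly_one3 (interior_of psi v f1) (interior_of psi v f2)
                       (interior_of psi v f3)
      | _ => False
      end).

(** * The random walk.
    From v, with v^+, v^- the endpoints of the segment containing psi(v) in its
    interior, the continuous-time walk jumps to v^{+-} at rate 1/|v^{+-} - v|;
    its jump chain goes to v^{+-} with probability r_{+-}/(r_+ + r_-).
    [step psi f x] is the expectation of f after one jump from x. *)
Definition rate (psi : V -> Cx) (x y : V) : R := / Cabs (Csub (psi y) (psi x)).

Definition step (psi : V -> Cx) (f : V -> R) (x : V) : R :=
  fold_right Rplus 0
    (map (fun ab : V * V =>
            if excluded_middle_informative (interior_of psi x ab) then
              (rate psi x (fst ab) * f (fst ab) + rate psi x (snd ab) * f (snd ab))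
              / (rate psi x (fst ab) + rate psi x (snd ab))
            else 0)
         (inc_black x)).

Definition Veqb (x y : V) : bool :=
  (Z.eqb (fst x) (fst y) && Z.eqb (snd x) (snd y))%bool.

(** [hit psi v n x] = probability that the walk started at x visits v within
    n jumps (time 0 included). *)
Fixpoint hit (psi : V -> Cx) (v : V) (n : nat) (x : V) : R :=
  match n with
  | O => if Veqb x v then 1 else 0
  | S k => if Veqb x v then 1 else step psi (hit psi v k) x
  end.

(** probability that the walk started at v returns to v within n+1 jumps *)
Definition ret_within (psi : V -> Cx) (v : V) (n : nat) : R :=
  step psi (hit psi v n) v.

(** Recurrence: from every vertex the walk returns almost surely, i.e.
    P(return within n+1 jumps) -> 1. *)
Definition recurrent (psi : V -> Cx) : Prop :=
  forall v : V, Un_cv (ret_within psi v) 1.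

(* Main.v *)
From Stdlib Require Import Reals Lra Lia ZArith List ClassicalEpsilon.
From Coquelicot Require Import Coquelicot.
Require Import Defs.
Import ListNotations.
Open Scope R_scope.

(** Write a, b, c for the angles of the triangle, attach to the vertex (m,n) the phase
    y = y0 + m c - n b with lam eta(m,n) = - exp(2iy), and put E = exp(2iy), P = exp(2ic),
    Q = exp(-2ib). Since the origami map is a geometric sum, up to an affine change of coordinates
    psi is z = (1-P) m + (1-Q) n + E, and y modulo pi, compared with 0 < c < c+a < pi,
    decides which black face contains the vertex in its interior.

    The walk is a martingale whose quadratic variation has a direction depending on the vertex,
    but this anisotropy has an explicit bounded corrector: with g = E^2 - (1+P+Q) E - PQ/E,
    the function z^2 - g is harmonic for the walk. It follows that
    log|z| - M/|z| + Re(g/z^2) (1/2 + 3M/(4|z|)) is superharmonic far away when M is large; it tends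
    to infinity, so the walk always comes back to a finite set.

    It remains to see that every vertex can be reached from every other. By symmetry let c be
    the smallest angle. A vertex with phase in (0,c) lies on two directed 3-cycles, through which all six neighbours are reached;
    the other vertices are handled by following the walk along rows of the lattice. *)

(** * Taylor estimates *)

Lemma Rabs_le_between_half (x : R) : Rabs x <= 1 / 2 -> - (1 / 2) <= x <= 1 / 2.
Proof. unfold Rabs. destruct (Rcase_abs x); lra. Qed.

(** The error term has derivative [t ^ 2 / (1 + t)], at most [2 * t ^ 2] in absolute value for
    [|t| <= 1/2]; the mean value theorem then gives a cubic bound. *)
Lemma ln_taylor2 (x : R) :
  Rabs x <= 1 / 2 -> Rabs (ln (1 + x) - (x - x ^ 2 / 2)) <= 2 * Rabs x ^ 3.
Proof.
  intros Hx. pose proof (Rabs_le_between_half x Hx) as Hb.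
  set (f := fun t => ln (1 + t) - (t - t ^ 2 / 2)).
  assert (Hd : forall t, -1 < t -> is_derive f t (t ^ 2 / (1 + t))).
  { intros t Ht. unfold f. auto_derive; [lra|]. field. lra. }
  destruct (MVT_gen f 0 x (fun t => t ^ 2 / (1 + t))) as [c [Hc Heq]].
  - intros t Ht. apply Hd. unfold Rmin, Rmax in Ht. destruct (Rle_dec 0 x); lra.
  - intros t Ht. apply continuity_pt_filterlim.
    apply (ex_derive_continuous f). eexists. apply Hd.
    unfold Rmin, Rmax in Ht. destruct (Rle_dec 0 x); lra.
  - assert (H0 : f 0 = 0) by (unfold f; rewrite Rplus_0_r, ln_1; lra).
    rewrite H0, !Rminus_0_r in Heq. fold (f x). rewrite Heq, Rabs_mult.
    assert (Hcx : Rabs c <= Rabs x).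
    { unfold Rmin, Rmax in Hc. destruct (Rle_dec 0 x).
      - rewrite !Rabs_right; lra.
      - rewrite !Rabs_left1; lra. }
    assert (Hcb := Rabs_le_between_half c ltac:(lra)).
    assert (Hc2 : c ^ 2 <= Rabs x ^ 2).
    { rewrite <- (pow2_abs c). apply pow_incr. split; [apply Rabs_pos|exact Hcx]. }
    assert (Hi : / (1 + c) <= 2).
    { replace 2 with (/ (1 / 2)) by field. apply Rinv_le_contravar; lra. }
    assert (Hi0 : 0 < / (1 + c)) by (apply Rinv_0_lt_compat; lra).
    rewrite Rabs_right.
    2:{ apply Rle_ge, Rmult_le_pos; [apply pow2_ge_0|lra]. }
    replace (2 * Rabs x ^ 3) with (Rabs x ^ 2 * 2 * Rabs x) by ring.
    apply Rmult_le_compat_r; [apply Rabs_pos|].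
    apply Rmult_le_compat; try lra. apply pow2_ge_0.
Qed.

(** Here [w] is [1 / sqrt (1 + x)], described algebraically: multiplying the error by its conjugate
    factor turns the estimate into a polynomial identity. *)
Lemma inv_sqrt_taylor2 (w x : R) :
  0 < w -> w ^ 2 * (1 + x) = 1 -> Rabs x <= 1 / 2 ->
  Rabs (w - (1 - x / 2 + 3 * x ^ 2 / 8)) <= 4 * Rabs x ^ 3.
Proof.
  intros Hw Hwx Hx. pose proof (Rabs_le_between_half x Hx) as Hb.
  set (P := 1 - x / 2 + 3 * x ^ 2 / 8).
  assert (HP : 3 / 4 <= P) by (unfold P; nra).
  (* [1 - P^2 (1+x)] is divisible by [x^3] *)
  assert (Hid : (w - P) * ((w + P) * (1 + x)) = x ^ 3 * (- (5 / 8) + 15 / 64 * x - 9 / 64 * x ^ 2)).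
  { replace ((w - P) * ((w + P) * (1 + x))) with (w ^ 2 * (1 + x) - P ^ 2 * (1 + x)) by ring.
    rewrite Hwx. unfold P. field. }
  assert (Hs : 3 / 8 <= (w + P) * (1 + x)) by nra.
  assert (Hq : Rabs (- (5 / 8) + 15 / 64 * x - 9 / 64 * x ^ 2) <= 1).
  { apply Rabs_le. nra. }
  apply (f_equal Rabs) in Hid. rewrite !Rabs_mult in Hid.
  rewrite (Rabs_right ((w + P))), (Rabs_right (1 + x)) in Hid by lra.
  rewrite <- RPow_abs in Hid.
  assert (0 <= Rabs x ^ 3) by (apply pow_le, Rabs_pos).
  assert (0 <= Rabs (w - P)) by apply Rabs_pos.
  nra.
Qed.

Section ComplexTaylor.
Local Open Scope C_scope.

Lemma Cmod_sq (z : C) : (Cmod z ^ 2 = fst z ^ 2 + snd z ^ 2)%R.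
Proof.
  unfold Cmod. rewrite <- Rsqr_pow2, Rsqr_sqrt; [reflexivity|].
  apply Rplus_le_le_0_compat; apply pow2_ge_0.
Qed.

(** Writing [|1 + e| ^ 2 = 1 + x] with [x] real and of order [|e|] reduces the expansions in [e] to
    the two real ones above. *)
Lemma Cmod_small_facts (e : C) :
  (Cmod e <= 1 / 8)%R ->
  let x := (2 * fst e + Cmod e ^ 2)%R in
  (Cmod (1 + e) ^ 2 = 1 + x /\ Rabs x <= 3 * Cmod e /\ Rabs x <= 1 / 2 /\
   Rabs (fst e) <= Cmod e /\ 0 < Cmod (1 + e))%R.
Proof.
  intros He x.
  assert (H0 := Cmod_ge_0 e).
  assert (H1 : (Rabs (fst e) <= Cmod e)%R) by (apply (re_le_Cmod e)).
  assert (H2 : (Cmod (1 + e) ^ 2 = 1 + x)%R).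
  { unfold x. rewrite !Cmod_sq. destruct e; simpl. ring. }
  assert (H3 : (Rabs x <= 3 * Cmod e)%R).
  { unfold x. eapply Rle_trans; [apply Rabs_triang|].
    rewrite Rabs_mult, (Rabs_right 2), (Rabs_right (Cmod e ^ 2)) by (try lra; apply Rle_ge, pow2_ge_0).
    nra. }
  assert (H4 : (Rabs x <= 1 / 2)%R) by lra.
  repeat split; auto.
  destruct (Cmod_ge_0 (1 + e)) as [H|H]; auto.
  rewrite <- H in H2. apply Rabs_le_between_half in H4. lra.
Qed.

Lemma Rcube_abs_le (x r : R) : (Rabs x <= 3 * r -> Rabs x ^ 3 <= 27 * r ^ 3)%R.
Proof.
  intros H. replace (27 * r ^ 3)%R with ((3 * r) ^ 3)%R by ring.
  apply pow_incr. split; [apply Rabs_pos|exact H].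
Qed.

(** Real part of the complex expansion of [log (1 + e)]. *)
Lemma ln_Cmod_taylor2 (e : C) :
  (Cmod e <= 1 / 8)%R ->
  (Rabs (ln (Cmod (1 + e)) - fst (e - e * e / 2)%C) <= 50 * Cmod e ^ 3)%R.
Proof.
  intros He. destruct (Cmod_small_facts e He) as (H1 & H2 & H3 & H4 & H5).
  set (x := (2 * fst e + Cmod e ^ 2)%R) in *.
  assert (H0 := Cmod_ge_0 e).
  assert (Hl : (ln (Cmod (1 + e)) = ln (1 + x) / 2)%R).
  { rewrite <- H1. replace (Cmod (1 + e) ^ 2)%R with (Cmod (1 + e) * Cmod (1 + e))%R by ring.
    rewrite ln_mult by assumption. field. }
  assert (HT := ln_taylor2 x H3). assert (HC := Rcube_abs_le _ _ H2).
  set (r := Cmod e) in *.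
  assert (Hs : (snd e ^ 2 = r ^ 2 - fst e ^ 2)%R) by (unfold r; rewrite Cmod_sq; ring).
  assert (Hf : (fst (e - e * e / 2)%C = fst e - fst e ^ 2 + r ^ 2 / 2)%R).
  { replace (fst (e - e * e / 2)%C) with (fst e - (fst e ^ 2 - snd e ^ 2) / 2)%R
      by (destruct e; simpl; field).
    rewrite Hs. field. }
  rewrite Hf, Hl.
  replace (ln (1 + x) / 2 - (fst e - fst e ^ 2 + r ^ 2 / 2))%R
    with ((ln (1 + x) - (x - x ^ 2 / 2)) / 2 + (- (fst e * r ^ 2) - r ^ 4 / 4))%R
    by (unfold x; field).
  apply Rabs_le. apply Rabs_le_between in HT.
  apply Rabs_le_between in H4.
  assert (0 <= r ^ 2)%R by apply pow2_ge_0.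
  assert (0 <= r ^ 3)%R by (apply pow_le; lra).
  assert (- r ^ 3 <= fst e * r ^ 2 <= r ^ 3)%R by nra.
  assert (0 <= r ^ 4 <= r ^ 3)%R by (replace (r ^ 4)%R with (r ^ 3 * r)%R by ring; nra).
  lra.
Qed.

(** This is the product of the expansion [1 - e/2 + 3 e^2/8] of [(1 + e)^(-1/2)] with its conjugate.
    The isotropic term [|e|^2 / 4] is the source of the later gain. *)
Lemma inv_Cmod_taylor2 (e : C) :
  (Cmod e <= 1 / 8)%R ->
  (Rabs (/ Cmod (1 + e) - (1 - fst e + Cmod e ^ 2 / 4 + 3 / 4 * fst (e * e)%C))
     <= 150 * Cmod e ^ 3)%R.
Proof.
  intros He. destruct (Cmod_small_facts e He) as (H1 & H2 & H3 & H4 & H5).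
  set (x := (2 * fst e + Cmod e ^ 2)%R) in *.
  assert (H0 := Cmod_ge_0 e).
  assert (HT := inv_sqrt_taylor2 (/ Cmod (1 + e)) x).
  assert (HC := Rcube_abs_le _ _ H2).
  set (r := Cmod e) in *.
  assert (Hs : (snd e ^ 2 = r ^ 2 - fst e ^ 2)%R) by (unfold r; rewrite Cmod_sq; ring).
  assert (Hf : (fst (e * e)%C = 2 * fst e ^ 2 - r ^ 2)%R).
  { replace (fst (e * e)%C) with (fst e ^ 2 - snd e ^ 2)%R by (destruct e; simpl; ring).
    rewrite Hs. ring. }
  rewrite Hf.
  specialize (HT ltac:(now apply Rinv_0_lt_compat)).
  specialize (HT ltac:(rewrite <- H1; field; lra) H3).
  replace (/ Cmod (1 + e) - (1 - fst e + r ^ 2 / 4 + 3 / 4 * (2 * fst e ^ 2 - r ^ 2)))%R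
    with ((/ Cmod (1 + e) - (1 - x / 2 + 3 * x ^ 2 / 8)) + (3 / 2 * (fst e * r ^ 2) + 3 / 8 * r ^ 4))%R
    by (unfold x; field; lra).
  apply Rabs_le. apply Rabs_le_between in HT.
  apply Rabs_le_between in H4.
  assert (0 <= r ^ 2)%R by apply pow2_ge_0.
  assert (0 <= r ^ 3)%R by (apply pow_le; lra).
  assert (- r ^ 3 <= fst e * r ^ 2 <= r ^ 3)%R by nra.
  assert (0 <= r ^ 4 <= r ^ 3)%R by (replace (r ^ 4)%R with (r ^ 3 * r)%R by ring; nra).
  lra.
Qed.

Lemma Cmod_one_plus_bounds (e : C) :
  (1 - Cmod e <= Cmod (1 + e) <= 1 + Cmod e)%R.
Proof.
  split.
  - assert (H := Cmod_triangle (1 + e) (- e)).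
    replace (1 + e + - e) with (RtoC 1) in H by ring.
    rewrite Cmod_1, Cmod_opp in H. lra.
  - assert (H := Cmod_triangle 1 e). rewrite Cmod_1 in H. lra.
Qed.

(** Together with [inv_cube_bound], controls how the weights [1 / z^2] and [1 / (z^2 |z|)] of the
    corrector in [lyap] change under a relative displacement [e]. *)
Lemma inv_sq_bound (e : C) :
  (Cmod e <= 1 / 8)%R -> (Cmod (/ ((1 + e) * (1 + e)) - 1) <= 3 * Cmod e)%R.
Proof.
  intros He. assert (Hb := Cmod_one_plus_bounds e). assert (H0 := Cmod_ge_0 e).
  assert (Hn : 1 + e <> 0).
  { intros Hz. rewrite Hz, Cmod_0 in Hb. lra. }
  replace (/ ((1 + e) * (1 + e)) - 1) with (- (e * (1 + (1 + e))) / ((1 + e) * (1 + e)))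
    by (field; auto).
  rewrite Cmod_div by (apply Cmult_neq_0; auto).
  rewrite Cmod_opp, !Cmod_mult.
  assert (H2 : (Cmod (1 + (1 + e)) <= 1 + Cmod (1 + e))%R).
  { assert (H := Cmod_triangle 1 (1 + e)). rewrite Cmod_1 in H. lra. }
  set (t := Cmod (1 + e)) in *.
  apply Rle_div_l; [nra|].
  assert (49 / 64 <= t * t)%R by nra.
  assert (Cmod e * Cmod (1 + (1 + e)) <= Cmod e * (17 / 8))%R by (apply Rmult_le_compat_l; lra).
  nra.
Qed.

Lemma inv_cube_bound (e : C) :
  (Cmod e <= 1 / 8)%R ->
  (Cmod (/ ((1 + e) * (1 + e)) * RtoC (/ Cmod (1 + e)) - 1) <= 6 * Cmod e)%R.
Proof.
  intros He. assert (Hb := Cmod_one_plus_bounds e). assert (H0 := Cmod_ge_0 e).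
  assert (H1 := inv_sq_bound e He).
  set (A := / ((1 + e) * (1 + e))) in *. set (t := Cmod (1 + e)) in *.
  replace (A * RtoC (/ t) - 1) with ((A - 1) * RtoC (/ t) + RtoC (/ t - 1)).
  2:{ rewrite RtoC_minus. ring. }
  eapply Rle_trans; [apply Cmod_triangle|].
  rewrite Cmod_mult, !Cmod_R.
  assert (Ht : (0 < / t <= 8 / 7)%R).
  { split. apply Rinv_0_lt_compat; lra.
    replace (8 / 7)%R with (/ (7 / 8))%R by field. apply Rinv_le_contravar; lra. }
  assert (Ht1 : (Rabs (/ t - 1) <= 8 / 7 * Cmod e)%R).
  { replace (/ t - 1)%R with ((1 - t) * / t)%R by (field; lra).
    rewrite Rabs_mult, (Rabs_right (/ t)) by lra.
    rewrite (Rmult_comm (8 / 7)). apply Rmult_le_compat; try apply Rabs_pos; try lra.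
    apply Rabs_le. lra. }
  rewrite (Rabs_right (/ t)) by lra.
  assert (0 <= Cmod (A - 1))%R by apply Cmod_ge_0.
  nra.
Qed.

End ComplexTaylor.

(** * The Lyapunov function *)

(** The weights [1/2] and [3/4 * (M / |z|)] are the opposites of the coefficients of [Re (e^2)] in
    the second order expansions of [ln |z|] and [- M / |z|]. *)
Definition lyap (M : R) (z g : C) : R :=
  ln (Cmod z) - M / Cmod z + fst (g / (z * z))%C * (1 / 2 + 3 / 4 * (M / Cmod z)).

Lemma fst_Cmult_R (z : C) (r : R) : fst (z * RtoC r)%C = fst z * r.
Proof. destruct z; simpl; ring. Qed.

Lemma fst_Cplus (z w : C) : fst (z + w)%C = fst z + fst w.
Proof. reflexivity. Qed.

Lemma fst_le_Cmod (z : C) : fst z <= Cmod z.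
Proof.
  assert (H : Rabs (fst z) <= Cmod z) by apply (re_le_Cmod z).
  apply Rabs_le_between in H. lra.
Qed.

(** Second order expansion in [e = d / z]. The last bracket collects the cubic remainders and the
    cost of evaluating the weight of [g1] at [z] rather than at [z + d]. *)
Lemma lyap_increment_le (M G : R) (z d g g1 : C) :
  0 <= M -> Cmod g1 <= G -> z <> 0 -> 8 * Cmod d <= Cmod z ->
  let D := Cmod z in
  let e := (d / z)%C in
  lyap M (z + d)%C g1 - lyap M z g <=
    fst e * (1 + M / D) - fst (e * e)%C / 2
    - M / D * (Cmod e ^ 2 / 4 + 3 / 4 * fst (e * e)%C)
    + fst ((g1 - g) / (z * z))%C * (1 / 2 + 3 / 4 * (M / D))
    + (50 * Cmod e ^ 3 + M / D * (150 * Cmod e ^ 3)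
       + G / D ^ 2 * (3 / 2 + 9 / 2 * (M / D)) * Cmod e).
Proof.
  intros HM Hg Hz Hd D e.
  assert (HD : 0 < D) by (now apply Cmod_gt_0).
  assert (HMD : 0 <= M / D) by (apply Rdiv_le_0_compat; lra).
  assert (He : Cmod e <= 1 / 8).
  { unfold e. rewrite Cmod_div by assumption. apply Rle_div_l; [assumption|].
    unfold D. lra. }
  assert (He0 := Cmod_ge_0 e).
  destruct (Cmod_small_facts e He) as (_ & _ & _ & _ & Hpos).
  assert (Hne : (1 + e)%C <> 0) by (now apply Cmod_gt_0).
  assert (Hzd : (z + d = z * (1 + e))%C) by (unfold e; field; assumption).
  set (t := Cmod (1 + e)) in *.
  assert (Hm : Cmod (z + d)%C = D * t) by (rewrite Hzd, Cmod_mult; reflexivity).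
  assert (HT1 := ln_Cmod_taylor2 e He). assert (HT2 := inv_Cmod_taylor2 e He).
  assert (HB1 := inv_sq_bound e He). assert (HB2 := inv_cube_bound e He).
  fold t in HT1, HT2, HB1, HB2.
  set (A := (/ ((1 + e) * (1 + e)))%C) in *.
  apply Rabs_le_between in HT1. apply Rabs_le_between in HT2.
  assert (Hln : ln (Cmod (z + d)%C) = ln D + ln t) by (rewrite Hm; apply ln_mult; assumption).
  (* The constants [3/2] and [9/2] are [1/2 * 3] and [3/4 * 6], with the factors 3 and 6 of
     [inv_sq_bound] and [inv_cube_bound]. *)
  assert (Hc : fst (g1 / ((z + d) * (z + d)))%C * (1 / 2 + 3 / 4 * (M / Cmod (z + d)%C))
     - fst (g1 / (z * z))%C * (1 / 2 + 3 / 4 * (M / D))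
     <= G / D ^ 2 * (3 / 2 + 9 / 2 * (M / D)) * Cmod e).
  { rewrite <- !fst_Cmult_R.
    set (X := (g1 / ((z + d) * (z + d)) * RtoC (1 / 2 + 3 / 4 * (M / Cmod (z + d)%C)))%C).
    set (Y := (g1 / (z * z) * RtoC (1 / 2 + 3 / 4 * (M / D)))%C).
    replace (fst X - fst Y) with (fst (X - Y)%C) by reflexivity.
    eapply Rle_trans; [apply fst_le_Cmod|].
    replace (X - Y)%C with
      (g1 / (z * z) * (RtoC (1 / 2) * (A - 1) + RtoC (3 / 4 * (M / D)) * (A * RtoC (/ t) - 1)))%C.
    2:{ unfold X, Y.
        replace (1 / 2 + 3 / 4 * (M / Cmod (z + d)%C)) with (1 / 2 + 3 / 4 * (M / D) * / t)
          by (rewrite Hm; field; lra).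
        rewrite Hzd, !RtoC_plus, (RtoC_mult (3 / 4 * (M / D))).
        generalize (RtoC (1 / 2)), (RtoC (3 / 4 * (M / D))), (RtoC (/ t)). intros.
        unfold A. field. auto. }
    rewrite Cmod_mult, Cmod_div by (now apply Cmult_neq_0).
    rewrite Cmod_mult. fold D.
    replace (D * D) with (D ^ 2) by ring.
    rewrite Rmult_assoc.
    apply Rmult_le_compat; try apply Cmod_ge_0.
    - apply Rdiv_le_0_compat; [apply Cmod_ge_0|nra].
    - unfold Rdiv. apply Rmult_le_compat_r; [|assumption].
      left. apply Rinv_0_lt_compat. nra.
    - eapply Rle_trans; [apply Cmod_triangle|].
      rewrite !Cmod_mult, !Cmod_R, (Rabs_right (1 / 2)), (Rabs_right (3 / 4 * (M / D))) by lra.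
      set (a := Cmod (A - 1)) in *. set (b := Cmod (A * RtoC (/ t) - 1)) in *.
      assert (M / D * b <= M / D * (6 * Cmod e)) by (apply Rmult_le_compat_l; assumption).
      nra. }
  assert (Hg2 : fst ((g1 - g) / (z * z))%C = fst (g1 / (z * z))%C - fst (g / (z * z))%C).
  { replace ((g1 - g) / (z * z))%C with (g1 / (z * z) - g / (z * z))%C by (field; assumption).
    reflexivity. }
  assert (Hinv : M / Cmod (z + d)%C = M / D * / t) by (rewrite Hm; field; lra).
  assert (Hi : M / D * (1 - fst e + Cmod e ^ 2 / 4 + 3 / 4 * fst (e * e)%C - 150 * Cmod e ^ 3)
               <= M / D * / t) by (apply Rmult_le_compat_l; lra).
  assert (Hf : fst (e - e * e / 2)%C = fst e - fst (e * e)%C / 2).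
  { destruct e; simpl; field. }
  unfold lyap. rewrite Hln. fold D. rewrite Hg2. rewrite Hf in HT1.
  rewrite Rmult_minus_distr_r.
  rewrite Hinv in Hc |- *.
  lra.
Qed.

(* The equation for [g] says that [z^2 - g] is preserved in mean, which cancels the anisotropic
   part of the second order terms; what is left is the gain [- M (p + m) / (4 |z|^3)] of the
   [- M / |z|] term, against errors of order [(1 + M / |z|) / |z|^3]. *)
Lemma lyap_superharmonic (G K l : R) :
  0 < l -> 0 <= G -> 0 < K ->
  exists M r : R, 0 <= M /\ 0 < r /\
    forall (z g g1 g2 u : C) (p m : R),
      Cmod g1 <= G -> Cmod g2 <= G -> Cmod u = 1 ->
      0 < p <= K -> 0 < m <= K -> l <= p + m ->
      ((g1 - g) / p + (g2 - g) / m = u * u * (p + m))%C ->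
      r <= Cmod z ->
      (lyap M (z + p * u)%C g1 - lyap M z g) / p
      + (lyap M (z - m * u)%C g2 - lyap M z g) / m < 0.
Proof.
  intros Hl HG HK.
  (* Error per unit of displacement, split into the part without [M / |z|] and the part carrying it;
     [3/2] and [9/2] are rounded up to 2 and 5. *)
  set (c1 := 50 * K ^ 2 + 2 * G). set (c2 := 150 * K ^ 2 + 5 * G).
  assert (HK2 : 0 < K ^ 2) by (apply pow_lt; assumption).
  assert (Hc1 : 0 < c1) by (unfold c1; lra).
  assert (Hc2 : 0 < c2) by (unfold c2; lra).
  (* Far away the total error [2 * B] is below [4 * c1], and this [M] makes the gain
     [M * (p + m) / 4] at least [4 * c1]. *)
  set (M := 16 * c1 / l).
  assert (HM : 0 < M) by (unfold M; apply Rdiv_lt_0_compat; lra).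
  (* The summand [8 * K] makes the jumps small relative to [|z|]; the next one ensures
     [M / |z| * c2 < c1]. *)
  exists M, (8 * K + M * c2 / c1 + 1).
  assert (Hq : 0 < M * c2 / c1) by (apply Rdiv_lt_0_compat; [nra|lra]).
  split; [lra|]. split; [lra|].
  intros z g g1 g2 u p m Hg1 Hg2 Hu Hp Hm Hpm Heq Hz.
  set (D := Cmod z) in *.
  assert (HD : 0 < D) by lra.
  assert (Hz0 : z <> 0) by (apply Cmod_gt_0; assumption).
  assert (Hp0 : RtoC p <> 0) by (intros H; apply RtoC_inj in H; lra).
  assert (Hm0 : RtoC m <> 0) by (intros H; apply RtoC_inj in H; lra).
  set (T := fst (u * u / (z * z))%C).
  set (B := c1 + M / D * c2).
  assert (HMD : 0 < M / D) by (apply Rdiv_lt_0_compat; assumption).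
  (* Both jumps are treated at once through a signed displacement, later [p] or [- m]. *)
  assert (Hone : forall (s : R) (gg : C), 0 < Rabs s <= K -> Cmod gg <= G ->
    lyap M (z + s * u)%C gg - lyap M z g <=
      s * (fst (u / z)%C * (1 + M / D)) - s ^ 2 * T / 2
      - M / D * (s ^ 2 / D ^ 2 / 4 + 3 / 4 * (s ^ 2 * T))
      + fst ((gg - g) / (z * z))%C * (1 / 2 + 3 / 4 * (M / D)) + Rabs s * (B / D ^ 3)).
  { intros s gg Hs Hgg.
    assert (Hsu : Cmod (s * u)%C = Rabs s) by (rewrite Cmod_mult, Cmod_R, Hu; ring).
    assert (H := lyap_increment_le M G z (s * u)%C g gg ltac:(lra) Hgg Hz0
                   ltac:(rewrite Hsu; fold D; lra)).
    cbv zeta in H. fold D in H.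
    assert (E1 : fst (s * u / z)%C = s * fst (u / z)%C).
    { replace (s * u / z)%C with (u / z * s)%C by (field; assumption).
      rewrite fst_Cmult_R. ring. }
    assert (E2 : fst (s * u / z * (s * u / z))%C = s ^ 2 * T).
    { replace (s * u / z * (s * u / z))%C with (u * u / (z * z) * RtoC (s ^ 2))%C.
      rewrite fst_Cmult_R. unfold T. ring.
      replace (s ^ 2) with (s * s) by ring. rewrite RtoC_mult. field. assumption. }
    assert (E3 : Cmod (s * u / z)%C = Rabs s / D).
    { rewrite Cmod_div, Hsu by assumption. reflexivity. }
    rewrite E1, E2, E3 in H.
    eapply Rle_trans; [exact H|].
    assert (Hs2 : (Rabs s / D) ^ 2 = s ^ 2 / D ^ 2).
    { rewrite <- (pow2_abs s). field. lra. }
    rewrite Hs2.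
    assert (Herr : 50 * (Rabs s / D) ^ 3 + M / D * (150 * (Rabs s / D) ^ 3)
        + G / D ^ 2 * (3 / 2 + 9 / 2 * (M / D)) * (Rabs s / D) <= Rabs s * (B / D ^ 3)).
    { replace (50 * (Rabs s / D) ^ 3 + M / D * (150 * (Rabs s / D) ^ 3)
        + G / D ^ 2 * (3 / 2 + 9 / 2 * (M / D)) * (Rabs s / D))
      with (Rabs s * ((50 * Rabs s ^ 2 + M / D * (150 * Rabs s ^ 2)
             + G * (3 / 2 + 9 / 2 * (M / D))) / D ^ 3)) by (field; lra).
      apply Rmult_le_compat_l; [lra|].
      apply (Rmult_le_compat_r (/ D ^ 3)).
      { left. apply Rinv_0_lt_compat, pow_lt. assumption. }
      assert (Rabs s ^ 2 <= K ^ 2) by (apply pow_incr; lra).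
      unfold B, c1, c2.
      assert (M / D * Rabs s ^ 2 <= M / D * K ^ 2) by (apply Rmult_le_compat_l; lra).
      assert (0 <= M / D * G) by (apply Rmult_le_pos; lra).
      lra. }
    lra. }
  assert (H1 := Hone p g1 ltac:(rewrite Rabs_right; lra) Hg1).
  assert (H2 := Hone (- m) g2 ltac:(rewrite Rabs_left; lra) Hg2).
  rewrite (Rabs_right p) in H1 by lra.
  rewrite (Rabs_left (- m)), Ropp_involutive in H2 by lra.
  replace (z + (- m)%R * u)%C with (z - m * u)%C in H2.
  2:{ rewrite RtoC_opp. ring. }
  set (d1 := lyap M (z + p * u)%C g1 - lyap M z g) in *.
  set (d2 := lyap M (z - m * u)%C g2 - lyap M z g) in *.
  set (F1 := fst ((g1 - g) / (z * z))%C) in *.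
  set (F2 := fst ((g2 - g) / (z * z))%C) in *.
  (* The equation for [g], divided by [z^2], in real parts. *)
  assert (HF : F1 / p + F2 / m = T * (p + m)).
  { unfold F1, F2, T. rewrite <- fst_Cmult_R.
    replace (fst ((g1 - g) / (z * z))%C / p) with (fst ((g1 - g) / (z * z) * RtoC (/ p))%C)
      by (rewrite fst_Cmult_R; reflexivity).
    replace (fst ((g2 - g) / (z * z))%C / m) with (fst ((g2 - g) / (z * z) * RtoC (/ m))%C)
      by (rewrite fst_Cmult_R; reflexivity).
    rewrite <- fst_Cplus. f_equal.
    rewrite !RtoC_inv, RtoC_plus by lra.
    transitivity (((g1 - g) / p + (g2 - g) / m) / (z * z))%C; [field; auto|].
    rewrite Heq. field. assumption. }
  assert (H1' : d1 / p <= fst (u / z)%C * (1 + M / D) - p * T / 2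
      - M / D * (p / D ^ 2 / 4 + 3 / 4 * (p * T)) + F1 / p * (1 / 2 + 3 / 4 * (M / D)) + B / D ^ 3).
  { apply Rle_div_l; [lra|]. eapply Rle_trans; [exact H1|]. right. field. lra. }
  assert (H2' : d2 / m <= - (fst (u / z)%C * (1 + M / D)) - m * T / 2
      - M / D * (m / D ^ 2 / 4 + 3 / 4 * (m * T)) + F2 / m * (1 / 2 + 3 / 4 * (M / D)) + B / D ^ 3).
  { apply Rle_div_l; [lra|]. eapply Rle_trans; [exact H2|]. right. field. lra. }
  (* The first order terms cancel because of the weights [1 / p] and [1 / m], and all terms in [T]
     cancel by [HF]. *)
  assert (Hsum : d1 / p + d2 / m <= (2 * B - M * (p + m) / 4) / D ^ 3).
  { eapply Rle_trans; [apply (Rplus_le_compat _ _ _ _ H1' H2')|].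
    right.
    replace (F2 / m) with (T * (p + m) - F1 / p) by lra. field. lra. }
  assert (HB : 2 * B - M * (p + m) / 4 < 0).
  { assert (M / D * c2 < c1).
    { replace (M / D * c2) with (M * c2 / c1 * c1 / D) by (field; lra).
      apply Rlt_div_l; [assumption|]. nra. }
    assert (16 * c1 <= M * (p + m)).
    { replace (16 * c1) with (M * l) by (unfold M; field; lra).
      apply Rmult_le_compat_l; lra. }
    unfold B. lra. }
  assert (HD3 : 0 < / D ^ 3) by (apply Rinv_0_lt_compat, pow_lt; assumption).
  unfold Rdiv in Hsum at 3. nra.
Qed.

(** * A recurrence criterion *)

Definition walk_step (psi : V -> Cx) (x y1 y2 : V) (a : R) : Prop :=
  0 < a < 1 /\ forall f : V -> R, step psi f x = a * f y1 + (1 - a) * f y2.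

(** Reachability is phrased with closed sets instead of paths: the criterion below applies it to the
    set where a function attains its maximum. *)
Definition irreducible (psi : V -> Cx) : Prop :=
  forall S : V -> Prop,
    (forall x y1 y2 a, walk_step psi x y1 y2 a -> S x -> S y1 /\ S y2) ->
    forall x0 x, S x0 -> S x.

Lemma Veqb_eq (x y : V) : Veqb x y = true <-> x = y.
Proof.
  unfold Veqb. rewrite Bool.andb_true_iff, !Z.eqb_eq.
  destruct x, y; simpl. split; [intros []; congruence | intros [= -> ->]; auto].
Qed.

Lemma list_argmax {A : Type} (f : A -> R) (x : A) (l : list A) :
  exists y, In y (x :: l) /\ forall z, In z (x :: l) -> f z <= f y.
Proof.
  induction l as [|b l IH].
  - exists x. split; [now left|]. intros z [<-|[]]; lra.
  - destruct IH as [y [Hy Hm]]. destruct (Rle_dec (f b) (f y)).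
    + exists y. split; [destruct Hy; simpl; auto|].
      intros z [<-|[<-|Hz]]; try lra; apply Hm; simpl; auto.
    + exists b. split; [simpl; auto|].
      intros z [<-|[<-|Hz]]; try lra;
        (apply Rle_trans with (f y); [apply Hm; simpl; auto|lra]).
Qed.

Section Recurrence.
Variable psi : V -> Cx.
Hypothesis walk_total : forall x, exists y1 y2 a, walk_step psi x y1 y2 a.

Lemma step_le (f g : V -> R) (x : V) : (forall y, f y <= g y) -> step psi f x <= step psi g x.
Proof.
  intros H. destruct (walk_total x) as (y1 & y2 & a & Ha & E). rewrite !E.
  specialize (H y1) as H1. specialize (H y2) as H2. nra.
Qed.

Lemma step_const (r : R) (x : V) : step psi (fun _ => r) x = r.
Proof. destruct (walk_total x) as (y1 & y2 & a & Ha & E). rewrite E. ring. Qed.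

Lemma hit_bounds (v : V) (n : nat) (x : V) : 0 <= hit psi v n x <= 1.
Proof.
  revert x. induction n as [|n IH]; intros x; simpl; destruct (Veqb x v); try lra.
  split.
  - rewrite <- (step_const 0 x). apply step_le. intros; apply IH.
  - rewrite <- (step_const 1 x). apply step_le. intros; apply IH.
Qed.

Lemma hit_growing (v : V) (n : nat) (x : V) : hit psi v n x <= hit psi v (S n) x.
Proof.
  revert x. induction n as [|n IH]; intros x.
  - simpl. destruct (Veqb x v); [lra|].
    rewrite <- (step_const 0 x) at 1. apply step_le. intros; apply (hit_bounds v 0).
  - change (hit psi v (S n) x) with (if Veqb x v then 1 else step psi (hit psi v n) x).
    change (hit psi v (S (S n)) x) with (if Veqb x v then 1 else step psi (hit psi v (S n)) x).
    destruct (Veqb x v); [lra|]. now apply step_le.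
Qed.

Lemma hit_cv (v : V) : exists H : V -> R, forall x, Un_cv (fun n => hit psi v n x) (H x).
Proof.
  assert (E : forall x, { l : R | Un_cv (fun n => hit psi v n x) l }).
  { intros x. apply growing_cv.
    - intros n. apply hit_growing.
    - exists 1. intros r [n ->]. apply hit_bounds. }
  exists (fun x => proj1_sig (E x)). intros x. apply (proj2_sig (E x)).
Qed.

Lemma step_cv (u : nat -> V -> R) (U : V -> R) (x : V) :
  (forall y, Un_cv (fun n => u n y) (U y)) -> Un_cv (fun n => step psi (u n) x) (step psi U x).
Proof.
  intros H. destruct (walk_total x) as (y1 & y2 & a & Ha & E). rewrite E.
  apply Un_cv_ext with (fun n => a * u n y1 + (1 - a) * u n y2).
  { intros n. now rewrite E. }
  assert (Hc : forall r, Un_cv (fun _ => r) r).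
  { intros r eps He. exists 0%nat. intros. rewrite R_dist_eq. exact He. }
  apply CV_plus; apply CV_mult; auto.
Qed.

(* With [u x] the probability that [x] never reaches [v], the function [u - eps h] has no maximum
   outside [F]; so [u] attains its maximum, on a set which the walk cannot leave
   unless this maximum is [0]. *)
Theorem recurrent_of_lyapunov (h : V -> R) (F : list V) :
  (forall K, exists l : list V, forall x, h x <= K -> In x l) ->
  (forall x, ~ In x F -> step psi h x < h x) ->
  irreducible psi ->
  recurrent psi.
Proof.
  intros Hfin Hsup Hirr v.
  destruct (hit_cv v) as [H HH].
  set (u := fun x => 1 - H x).
  assert (Hb : forall x, 0 <= H x <= 1).
  { intros x. split.
    - apply (Rle_cv_lim (Un := fun _ => 0) (Vn := fun n => hit psi v n x)); auto.
      + intros n; apply hit_bounds.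
      + intros eps He. exists 0%nat. intros. rewrite R_dist_eq. exact He.
    - apply (Rle_cv_lim (Un := fun n => hit psi v n x) (Vn := fun _ => 1)); auto.
      + intros n; apply hit_bounds.
      + intros eps He. exists 0%nat. intros. rewrite R_dist_eq. exact He. }
  assert (Hv : H v = 1).
  { apply (UL_sequence (fun n => hit psi v n v)); auto.
    intros eps He. exists 0%nat. intros n _.
    assert (E : Veqb v v = true) by (now apply Veqb_eq).
    destruct n; simpl; rewrite E, R_dist_eq; exact He. }
  assert (Hstep : forall x, x <> v -> H x = step psi H x).
  { intros x Hx. apply (UL_sequence (fun n => hit psi v (S n) x)).
    - intros eps He. destruct (HH x eps He) as [N HN]. exists N. intros n Hn. apply HN. lia.
    - apply Un_cv_ext with (fun n => step psi (hit psi v n) x).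
      + intros n. simpl. destruct (Veqb x v) eqn:E; [|reflexivity].
        apply Veqb_eq in E. contradiction.
      + now apply step_cv. }
  assert (Hu : forall x y1 y2 a, walk_step psi x y1 y2 a -> x <> v ->
            u x = a * u y1 + (1 - a) * u y2).
  { intros x y1 y2 a [Ha E] Hx. unfold u. rewrite (Hstep x Hx), E. ring. }
  (* The maximum is taken over [v] and [F] together, the points where [u] may fail to be harmonic or
     [h] to be superharmonic. *)
  destruct (list_argmax u v F) as [x0 [Hx0 Hmax]].
  assert (Hmin : exists c, forall x, c <= h x).
  { destruct (Hfin 0) as [l Hl].
    destruct (list_argmax (fun x => - h x) v l) as [y [_ Hy]].
    exists (Rmin 0 (h y)). intros x. destruct (Rle_dec (h x) 0) as [Hx|Hx].
    - apply Rle_trans with (h y); [apply Rmin_r|].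
      specialize (Hy x (or_intror (Hl x Hx))). simpl in Hy. lra.
    - apply Rle_trans with 0; [apply Rmin_l|lra]. }
  destruct Hmin as [c Hc].
  assert (Hglob : forall x, u x <= u x0).
  { intros x1. apply Rnot_lt_le. intros Hlt.
    (* Small enough for the penalty at [x1] to use at most half of the gap [u x1 - u x0]. *)
    set (eps := (u x1 - u x0) / (2 * (h x1 - c + 1))).
    assert (Hden : 0 < h x1 - c + 1) by (specialize (Hc x1); lra).
    assert (Heps : 0 < eps) by (apply Rdiv_lt_0_compat; lra).
    set (phi := fun x => u x - eps * (h x - c)).
    assert (Hphi1 : u x0 < phi x1).
    { unfold phi.
      assert (eps * (h x1 - c) <= (u x1 - u x0) / 2).
      { unfold eps. apply Rle_trans with ((u x1 - u x0) / (2 * (h x1 - c + 1)) * (h x1 - c + 1)).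
        - apply Rmult_le_compat_l; [fold eps; lra|lra].
        - right. field. lra. }
      lra. }
    (* Where [h] exceeds this level, [phi] is negative since [u <= 1]; hence [phi] attains its
       maximum on a finite list. *)
    destruct (Hfin (c + 1 / eps)) as [l Hl].
    destruct (list_argmax phi x1 l) as [xs [_ Hxs]].
    assert (Hphi : forall x, phi x <= phi xs).
    { intros x. destruct (Rle_dec (h x) (c + 1 / eps)) as [Hx|Hx].
      - apply Hxs. right. now apply Hl.
      - apply Rle_trans with (phi x1); [|apply Hxs; now left].
        apply Rle_trans with (u x0); [|lra].
        apply Rle_trans with 0.
        2:{ unfold u. specialize (Hb x0). lra. }
        unfold phi.
        assert (1 < eps * (h x - c)).
        { replace 1 with (eps * (1 / eps)) by (field; lra).
          apply Rmult_lt_compat_l; lra. }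
        unfold u. specialize (Hb x). lra. }
    assert (Hs : u x0 < phi xs) by (apply Rlt_le_trans with (phi x1); auto).
    assert (HsF : forall y, In y (v :: F) -> phi y <= u x0).
    { intros y Hy. specialize (Hmax y Hy). unfold phi. specialize (Hc y).
      assert (0 <= eps * (h y - c)) by (apply Rmult_le_pos; lra). lra. }
    assert (HnF : ~ In xs (v :: F)) by (intros Hin; specialize (HsF xs Hin); lra).
    assert (Hsv : xs <> v) by (intros ->; apply HnF; now left).
    assert (HsF' : ~ In xs F) by (intros Hin; apply HnF; now right).
    specialize (Hsup xs HsF').
    destruct (walk_total xs) as (y1 & y2 & a & Hw).
    assert (Eu := Hu _ _ _ _ Hw Hsv). destruct Hw as [Ha E]. rewrite E in Hsup.
    assert (P1 := Hphi y1). assert (P2 := Hphi y2).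
    (* At [xs] the function [u] is harmonic and [h] strictly decreases in mean, so the mean of [phi]
       after a jump exceeds [phi xs], against maximality. *)
    assert (a * phi y1 + (1 - a) * phi y2 <= phi xs) by nra.
    unfold phi in *. rewrite Eu in *. nra. }
  assert (Hzero : u x0 <= 0).
  { apply Rnot_lt_le. intros Hpos.
    assert (Huv : u v = u x0).
    { apply (Hirr (fun x => u x = u x0)) with x0; [|reflexivity].
      intros x y1 y2 a Hw Hx.
      (* Since [u v = 0], a point with the positive maximal value is not [v]; harmonicity then
         forces both successors to attain the maximum, so the set reaches [v], a contradiction. *)
      assert (Hxv : x <> v) by (intros ->; unfold u in Hx, Hpos; lra).
      assert (Eu := Hu _ _ _ _ Hw Hxv). destruct Hw as [Ha _].
      assert (P1 := Hglob y1). assert (P2 := Hglob y2). rewrite Hx in Eu.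
      split; nra. }
    unfold u in *. lra. }
  assert (HH1 : forall x, H x = 1).
  { intros x. specialize (Hglob x). specialize (Hb x). unfold u in *. lra. }
  unfold ret_within.
  replace 1 with (step psi H v).
  - now apply step_cv.
  - destruct (walk_total v) as (y1 & y2 & a & Ha & E). rewrite E, !HH1. ring.
Qed.

End Recurrence.

(** * Irreducibility in terms of phases *)

Lemma floor_mult (X c : R) : 0 < c -> exists n : Z, 0 <= X - IZR n * c < c.
Proof.
  intros Hc. exists (Int_part (X / c)). destruct (base_Int_part (X / c)) as [H1 H2].
  set (N := IZR (Int_part (X / c))) in *.
  assert (E : X = X / c * c) by (field; lra).
  assert (N * c <= X / c * c) by (apply Rmult_le_compat_r; lra).
  assert (X / c * c < (N + 1) * c) by (apply Rmult_lt_compat_r; lra).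
  lra.
Qed.

Section Phases.
Variables (a b c y0 : R).
Hypotheses (Ha0 : 0 < a) (Hb0 : 0 < b) (Hc0 : 0 < c).
Let T := a + b + c.
Let Y (i j : Z) : R := y0 + IZR i * c + IZR j * b.

Definition phase_avoids_multiples : Prop := forall i j k : Z, Y i j <> IZR k * T.

(* The position [i e_c + j e_b], with [e_a = - e_b - e_c], carries the phase [Y i j] modulo [T];
   the walk moves along [e_a] or [- e_b] for phases in [(0, c)], along [e_b] or [- e_c] for
   phases in [(c, c + a)], and along [e_c] or [- e_a] for phases in [(c + a, T)]. *)
Definition closed_under_moves (S : Z -> Z -> Prop) : Prop :=
  forall i j k : Z, S i j -> let X := Y i j - IZR k * T in
    (0 < X < c -> S (i - 1)%Z (j - 1)%Z /\ S i (j - 1)%Z) /\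
    (c < X < c + a -> S i (j + 1)%Z /\ S (i - 1)%Z j) /\
    (c + a < X < T -> S (i + 1)%Z j /\ S (i + 1)%Z (j + 1)%Z).

Hypotheses (Hca : c <= a) (Hcb : c <= b) (Hnd : phase_avoids_multiples).
Variable S : Z -> Z -> Prop.
Hypothesis HS : closed_under_moves S.

Ltac phase := unfold Y, T in *; repeat rewrite ?plus_IZR, ?minus_IZR in *; lra.

(** The boundary phases [c] and [c + a = T - b] are excluded because they would give phase 0 modulo
    [T] to the positions [(i - 1, j)] and [(i, j + 1)]. *)
Lemma phase_classify (i j : Z) :
  exists k : Z, let X := Y i j - IZR k * T in
    0 < X < c \/ c < X < c + a \/ c + a < X < T.
Proof.
  destruct (floor_mult (Y i j) T) as [k Hk]; [unfold T; lra|].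
  exists k. cbv zeta.
  assert (H1 := Hnd i j k). assert (H2 := Hnd (i - 1)%Z j k). assert (H3 := Hnd i (j + 1)%Z (k + 1)%Z).
  assert (Y i j - IZR k * T <> c) by (intros E; apply H2; phase).
  assert (Y i j - IZR k * T <> c + a) by (intros E; apply H3; phase).
  lra.
Qed.

(* Both [e_a, e_b, e_c] and [-e_b, -e_a, -e_c] are 3-cycles of the walk
   through a point with phase in [(0, c)]. *)
Lemma closed_c_neighbours (i j k : Z) :
  0 < Y i j - IZR k * T < c -> S i j ->
  S (i - 1)%Z (j - 1)%Z /\ S i (j - 1)%Z /\ S (i - 1)%Z j /\ S (i + 1)%Z j
  /\ S i (j + 1)%Z /\ S (i + 1)%Z (j + 1)%Z.
Proof.
  intros Hk H. destruct (HS i j k H) as [[H1 H2] _]; [exact Hk|].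
  (* Modulo [T] the two successors have phases [X + a] and [X + a + c]; [c <= a] places the first in
     [(c, c + a)], and [c <= b] places the second in [(c + a, T)]. *)
  destruct (HS _ _ (k - 1)%Z H1) as [_ [[H3 _] _]]; [phase|].
  destruct (HS _ _ (k - 1)%Z H2) as [_ [_ [_ H4]]]; [phase|].
  replace (j - 1 + 1)%Z with j in * by lia.
  destruct (HS _ _ (k - 1)%Z H3) as [_ [_ [_ H5]]]; [phase|].
  destruct (HS _ _ k H4) as [_ [[H6 _] _]]; [phase|].
  replace (i - 1 + 1)%Z with i in * by lia.
  tauto.
Qed.

(** As the phase stays positive after the last step of size [c], every step starts above [c], where
    the walk can move along [- e_c]. *)
Lemma closed_walk_left (k : Z) (n : nat) : forall i j : Z,
  S i j -> Y i j - IZR k * T < c + a -> 0 < Y i j - IZR k * T - INR n * c ->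
  S (i - Z.of_nat n)%Z j.
Proof.
  induction n as [|n IH]; intros i j H H1 H2.
  - now replace (i - Z.of_nat 0)%Z with i by lia.
  - rewrite S_INR in H2. assert (0 <= INR n * c) by (apply Rmult_le_pos; [apply pos_INR|lra]).
    destruct (HS i j k H) as [_ [[_ H3] _]]; [phase|].
    replace (i - Z.of_nat (Datatypes.S n))%Z with (i - 1 - Z.of_nat n)%Z by lia.
    apply IH; [exact H3|phase|phase].
Qed.

(** Symmetrically, every step starts below [T], where the walk can move along [e_c]. *)
Lemma closed_walk_right (k : Z) (n : nat) : forall i j : Z,
  S i j -> c + a < Y i j - IZR k * T -> Y i j - IZR k * T + INR n * c < T + c ->
  S (i + Z.of_nat n)%Z j.
Proof.
  induction n as [|n IH]; intros i j H H1 H2.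
  - now replace (i + Z.of_nat 0)%Z with i by lia.
  - rewrite S_INR in H2. assert (0 <= INR n * c) by (apply Rmult_le_pos; [apply pos_INR|lra]).
    destruct (HS i j k H) as [_ [_ [H3 _]]]; [phase|].
    replace (i + Z.of_nat (Datatypes.S n))%Z with (i + 1 + Z.of_nat n)%Z by lia.
    apply IH; [exact H3|phase|phase].
Qed.

(** Steps of length [c] cannot jump over a window of length [c], and the hypothesis on phases rules
    out its endpoints. The shift [n + 1] records that at least one step is made. *)
Lemma next_c_right (i j k : Z) :
  Y i j < IZR k * T -> exists n : nat, 0 < Y i j + (INR n + 1) * c - IZR k * T < c.
Proof.
  intros H. destruct (floor_mult (IZR k * T - Y i j) c Hc0) as [n Hn].
  assert (0 <= n)%Z.
  { apply Z.lt_succ_r, lt_IZR. rewrite succ_IZR. nra. }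
  exists (Z.to_nat n). rewrite INR_IZR_INZ, Z2Nat.id by assumption.
  assert (Hq := Hnd (i + n)%Z j k).
  assert (IZR k * T - Y i j - IZR n * c <> 0) by (intros E; apply Hq; phase).
  lra.
Qed.

Lemma next_c_left (i j k : Z) :
  c < Y i j - IZR k * T -> exists n : nat, 0 < Y i j - (INR n + 1) * c - IZR k * T < c.
Proof.
  intros H. destruct (floor_mult (Y i j - IZR k * T - c) c Hc0) as [n Hn].
  assert (0 <= n)%Z.
  { apply Z.lt_succ_r, lt_IZR. rewrite succ_IZR. nra. }
  exists (Z.to_nat n). rewrite INR_IZR_INZ, Z2Nat.id by assumption.
  assert (Hq := Hnd (i - n - 1)%Z j k).
  assert (Y i j - IZR k * T - c - IZR n * c <> 0) by (intros E; apply Hq; phase).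
  lra.
Qed.

Lemma nat_index_le (l n : nat) : (l <= n)%nat -> INR l * c <= INR n * c.
Proof. intros H. apply Rmult_le_compat_r; [lra|now apply le_INR]. Qed.

(* From a phase in [(c, c + a)] move along [e_b], then along [e_c] to the next phase in [(0, c)]
   (by induction, since phases have increased), and come back through its neighbours. *)
Lemma closed_a_right (N : nat) : forall i j k : Z,
  c < Y i j - IZR k * T < c + a -> c + a - INR N * c < Y i j - IZR k * T ->
  S i j -> S (i + 1)%Z j.
Proof.
  induction N as [|N IH]; intros i j k Hk HN H.
  - simpl in HN. lra.
  - rewrite S_INR in HN.
    destruct (HS i j k H) as [_ [[H1 _] _]]; [exact Hk|].
    destruct (next_c_right i (j + 1)%Z (k + 1)%Z) as [n Hn]; [phase|].
    (* Before arrival the phases lie in [(c, T)]. Above [c + a] the walk itself moves along [e_c];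
       below, the induction hypothesis applies, the phase having grown by at least [b >= c]. *)
    assert (Hrun : forall l : nat, (l <= n + 1)%nat -> S (i + Z.of_nat l)%Z (j + 1)%Z).
    { induction l as [|l IHl]; intros Hl.
      - now replace (i + Z.of_nat 0)%Z with i by lia.
      - assert (H2 := IHl ltac:(lia)).
        assert (Hln := nat_index_le l n ltac:(lia)).
        assert (Hl0 := nat_index_le 0 l ltac:(lia)). simpl in Hl0.
        assert (E : Y (i + Z.of_nat l)%Z (j + 1)%Z = Y i j + INR l * c + b).
        { rewrite INR_IZR_INZ. phase. }
        assert (HX : c < Y (i + Z.of_nat l)%Z (j + 1)%Z - IZR k * T < T) by (rewrite E; phase).
        replace (i + Z.of_nat (Datatypes.S l))%Z with (i + Z.of_nat l + 1)%Z by lia.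
        destruct (Rtotal_order (Y (i + Z.of_nat l)%Z (j + 1)%Z - IZR k * T) (c + a)) as [Hlt|[Heq|Hgt]].
        + apply (IH _ _ k); [lra|rewrite E; phase|exact H2].
        + exfalso. apply (Hnd (i + Z.of_nat l)%Z (j + 1 + 1)%Z (k + 1)%Z). phase.
        + apply (HS _ _ k H2). lra. }
    assert (H2 := Hrun (n + 1)%nat ltac:(lia)).
    assert (Hw : 0 < Y (i + Z.of_nat (n + 1))%Z (j + 1)%Z - IZR (k + 1) * T < c).
    { rewrite Nat2Z.inj_add. change (Z.of_nat 1) with 1%Z. rewrite INR_IZR_INZ in Hn. phase. }
    destruct (closed_c_neighbours _ _ _ Hw H2) as (H3 & H4 & _).
    replace (j + 1 - 1)%Z with j in * by lia.
    (* The neighbours found in row [j] have first coordinates [i + n] and [i + n + 1]. For positive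
       [n], the former leads back to [i + 1] along [- e_c], its phase being below [c + a]. *)
    destruct n as [|n]; [exact H4|].
    replace (i + 1)%Z with (i + Z.of_nat (Datatypes.S n + 1) - 1 - Z.of_nat n)%Z by lia.
    rewrite S_INR in Hn.
    assert (E : Y (i + Z.of_nat (Datatypes.S n + 1) - 1)%Z j = Y i j + (INR n + 1) * c).
    { rewrite INR_IZR_INZ.
      replace (i + Z.of_nat (Datatypes.S n + 1) - 1)%Z with (i + Z.of_nat n + 1)%Z by lia. phase. }
    apply (closed_walk_left k); [exact H3| |]; rewrite E; phase.
Qed.

(** Mirror image of [closed_a_right]: move along [- e_a], then along [- e_c] down to a phase in
    [(0, c)]. The induction is on the height above [c + a], which drops by at least [a >= c]. *)
Lemma closed_b_left (N : nat) : forall i j k : Z,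
  c + a < Y i j - IZR k * T < T -> Y i j - IZR k * T < c + a + INR N * c ->
  S i j -> S (i - 1)%Z j.
Proof.
  induction N as [|N IH]; intros i j k Hk HN H.
  - simpl in HN. lra.
  - rewrite S_INR in HN.
    destruct (HS i j k H) as [_ [_ [_ H1]]]; [exact Hk|].
    destruct (next_c_left (i + 1)%Z (j + 1)%Z (k + 1)%Z) as [n Hn]; [phase|].
    assert (Hrun : forall l : nat, (l <= n + 1)%nat -> S (i + 1 - Z.of_nat l)%Z (j + 1)%Z).
    { induction l as [|l IHl]; intros Hl.
      - now replace (i + 1 - Z.of_nat 0)%Z with (i + 1)%Z by lia.
      - assert (H2 := IHl ltac:(lia)).
        assert (Hln := nat_index_le l n ltac:(lia)).
        assert (Hl0 := nat_index_le 0 l ltac:(lia)). simpl in Hl0.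
        assert (E : Y (i + 1 - Z.of_nat l)%Z (j + 1)%Z = Y i j + c - INR l * c + b).
        { rewrite INR_IZR_INZ. phase. }
        assert (HX : c < Y (i + 1 - Z.of_nat l)%Z (j + 1)%Z - IZR (k + 1) * T < T) by (rewrite E; phase).
        replace (i + 1 - Z.of_nat (Datatypes.S l))%Z with (i + 1 - Z.of_nat l - 1)%Z by lia.
        destruct (Rtotal_order (Y (i + 1 - Z.of_nat l)%Z (j + 1)%Z - IZR (k + 1) * T) (c + a)) as [Hlt|[Heq|Hgt]].
        + apply (HS _ _ (k + 1)%Z H2). lra.
        + exfalso. apply (Hnd (i + 1 - Z.of_nat l)%Z (j + 1 + 1)%Z (k + 1 + 1)%Z). phase.
        + apply (IH _ _ (k + 1)%Z); [lra|rewrite E; phase|exact H2]. }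
    assert (H2 := Hrun (n + 1)%nat ltac:(lia)).
    assert (Hw : 0 < Y (i + 1 - Z.of_nat (n + 1))%Z (j + 1)%Z - IZR (k + 1) * T < c).
    { rewrite Nat2Z.inj_add. change (Z.of_nat 1) with 1%Z. rewrite INR_IZR_INZ in Hn. phase. }
    destruct (closed_c_neighbours _ _ _ Hw H2) as (H3 & H4 & _).
    replace (j + 1 - 1)%Z with j in * by lia.
    destruct n as [|n].
    { now replace (i + 1 - Z.of_nat (0 + 1) - 1)%Z with (i - 1)%Z in H3 by lia. }
    replace (i - 1)%Z with (i + 1 - Z.of_nat (Datatypes.S n + 1) + Z.of_nat n)%Z by lia.
    rewrite S_INR in Hn.
    assert (E : Y (i + 1 - Z.of_nat (Datatypes.S n + 1))%Z j = Y i j - (INR n + 1) * c).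
    { rewrite INR_IZR_INZ.
      replace (i + 1 - Z.of_nat (Datatypes.S n + 1))%Z with (i - Z.of_nat n - 1)%Z by lia. phase. }
    apply (closed_walk_right k); [exact H4| |]; rewrite E; phase.
Qed.

Lemma closed_row_step (i j : Z) : S i j -> S (i + 1)%Z j /\ S (i - 1)%Z j.
Proof.
  intros H. destruct (phase_classify i j) as [k [Hk|[Hk|Hk]]].
  - split; now apply (closed_c_neighbours i j k).
  - split; [|now apply (HS i j k)].
    destruct (INR_unbounded ((c + a) / c)) as [N HN].
    apply (closed_a_right N i j k); auto.
    assert (c + a < INR N * c) by (apply Rlt_div_l; assumption). lra.
  - split; [now apply (HS i j k)|].
    destruct (INR_unbounded (T / c)) as [N HN].
    apply (closed_b_left N i j k); auto.
    assert (T < INR N * c) by (apply Rlt_div_l; assumption). lra.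
Qed.

Lemma closed_row (i j i' : Z) : S i j -> S i' j.
Proof.
  intros H. replace i' with (i + (i' - i))%Z by lia. generalize (i' - i)%Z. intros d.
  induction d using Z.peano_ind.
  - now replace (i + 0)%Z with i by lia.
  - replace (i + Z.succ d)%Z with (i + d + 1)%Z by lia. now apply closed_row_step.
  - replace (i + Z.pred d)%Z with (i + d - 1)%Z by lia. now apply closed_row_step.
Qed.

Lemma row_has_c (j : Z) : exists i k : Z, 0 < Y i j - IZR k * T < c.
Proof.
  destruct (floor_mult (Y 0 j) c Hc0) as [n Hn].
  exists (- n)%Z, 0%Z.
  assert (Hq := Hnd (- n)%Z j 0%Z).
  assert (E : Y (- n)%Z j = Y 0%Z j - IZR n * c) by (unfold Y; rewrite opp_IZR; lra).
  rewrite E in *. assert (Y 0 j - IZR n * c <> 0) by (intros Hz; apply Hq; lra).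
  lra.
Qed.

(** Rows are changed at a vertex of phase in [(0, c)], which exists in every row and has reachable
    neighbours on both sides. *)
Lemma closed_column_step (i j i' : Z) : S i j -> S i' (j + 1)%Z /\ S i' (j - 1)%Z.
Proof.
  intros H. destruct (row_has_c j) as (i1 & k & Hk).
  destruct (closed_c_neighbours i1 j k Hk (closed_row i j i1 H)) as (_ & H1 & _ & _ & H2 & _).
  split; eapply closed_row; eassumption.
Qed.

Lemma closed_everything (i j i' j' : Z) : S i j -> S i' j'.
Proof.
  intros H. apply (closed_row i). replace j' with (j + (j' - j))%Z by lia.
  generalize (j' - j)%Z. intros d.
  induction d using Z.peano_ind.
  - now replace (j + 0)%Z with j by lia.
  - replace (j + Z.succ d)%Z with (j + d + 1)%Z by lia. now apply (closed_column_step i).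
  - replace (j + Z.pred d)%Z with (j + d - 1)%Z by lia. now apply (closed_column_step i).
Qed.

End Phases.

(* The cyclic relabelling [(a, b, c) -> (b, c, a)] shifts the origin of phases by [c]. *)
Lemma rotate_avoids (a b c y0 : R) :
  phase_avoids_multiples a b c y0 -> phase_avoids_multiples b c a (y0 - c).
Proof.
  intros H i j k E. apply (H (j - i - 1)%Z (- i)%Z (k - i)%Z).
  repeat rewrite ?minus_IZR, ?opp_IZR. lra.
Qed.

(** The map [(i, j) -> (j - i, - i)] sends [e_c], [e_b], [e_a] to [e_a], [e_c], [e_b], in accordance
    with the relabelling of the angles. *)
Lemma rotate_closed (a b c y0 : R) (S : Z -> Z -> Prop) :
  closed_under_moves a b c y0 S ->
  closed_under_moves b c a (y0 - c) (fun i j => S (j - i)%Z (- i)%Z).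
Proof.
  intros HS i j k H X.
  (* The coordinate change costs [i] multiples of [T]. The last interval for the new labels wraps
     past [T], whence the index [k - i + 1] for it. *)
  destruct (HS _ _ (k - i)%Z H) as (_ & H2 & H3).
  destruct (HS _ _ (k - i + 1)%Z H) as (H1 & _ & _).
  repeat rewrite ?plus_IZR, ?minus_IZR, ?opp_IZR in H1.
  repeat rewrite ?minus_IZR, ?opp_IZR in H2, H3.
  unfold X.
  replace (j - 1 - (i - 1))%Z with (j - i)%Z by lia.
  replace (- (i - 1))%Z with (- i + 1)%Z by lia.
  replace (j - 1 - i)%Z with (j - i - 1)%Z by lia.
  replace (j + 1 - i)%Z with (j - i + 1)%Z by lia.
  replace (j - (i - 1))%Z with (j - i + 1)%Z by lia.
  replace (j - (i + 1))%Z with (j - i - 1)%Z by lia.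
  replace (j + 1 - (i + 1))%Z with (j - i)%Z by lia.
  replace (- (i + 1))%Z with (- i - 1)%Z by lia.
  split; [|split]; intros HX.
  - apply H2. lra.
  - apply H3. lra.
  - apply H1. lra.
Qed.

Lemma rotate_closed_everything (a b c y0 : R) :
  (forall S, closed_under_moves b c a (y0 - c) S -> forall i j i' j' : Z, S i j -> S i' j') ->
  forall S, closed_under_moves a b c y0 S -> forall i j i' j' : Z, S i j -> S i' j'.
Proof.
  intros H S HS i j i' j' Hij.
  assert (HT := H _ (rotate_closed _ _ _ _ _ HS) (- j)%Z (i - j)%Z (- j')%Z (i' - j')%Z).
  cbv beta in HT.
  replace (i - j - - j)%Z with i in HT by lia. replace (- - j)%Z with j in HT by lia.
  replace (i' - j' - - j')%Z with i' in HT by lia. replace (- - j')%Z with j' in HT by lia.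
  exact (HT Hij).
Qed.

Lemma closed_everything_any (a b c y0 : R) :
  0 < a -> 0 < b -> 0 < c -> phase_avoids_multiples a b c y0 ->
  forall S, closed_under_moves a b c y0 S -> forall i j i' j' : Z, S i j -> S i' j'.
Proof.
  intros Ha Hb Hc Hnd.
  assert (Hnd1 := rotate_avoids _ _ _ _ Hnd).
  assert (Hnd2 := rotate_avoids _ _ _ _ Hnd1).
  (* Zero, one or two rotations bring the smallest angle to the place of [c]. *)
  destruct (Rle_dec c a); destruct (Rle_dec c b); destruct (Rle_dec a b);
    solve [ apply closed_everything; auto; lra
          | apply rotate_closed_everything, closed_everything; auto; lra
          | do 2 apply rotate_closed_everything; apply closed_everything; auto; lra ].
Qed.

(** * The walk in coordinates *)

Definition cis (t : R) : C := (cos t, sin t).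

Lemma cis_plus (x y : R) : cis (x + y) = (cis x * cis y)%C.
Proof.
  unfold cis, Cmult; simpl. rewrite cos_plus, sin_plus. f_equal; ring.
Qed.

Lemma Cmod_cis (x : R) : Cmod (cis x) = 1.
Proof.
  unfold Cmod, cis; cbn [fst snd].
  replace (cos x ^ 2 + sin x ^ 2) with 1; [apply sqrt_1|].
  rewrite <- (sin2_cos2 x). unfold Rsqr. ring.
Qed.

Lemma cis_neq_0 (x : R) : cis x <> 0.
Proof. apply Cmod_gt_0. rewrite Cmod_cis. lra. Qed.

Lemma cis_0 : cis 0 = 1.
Proof. unfold cis. rewrite cos_0, sin_0. reflexivity. Qed.

Lemma cis_opp (x : R) : cis (- x) = (/ cis x)%C.
Proof.
  assert (H : (cis x * cis (- x) = 1)%C) by (rewrite <- cis_plus, Rplus_opp_r; apply cis_0).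
  transitivity (/ cis x * (cis x * cis (- x)))%C.
  - field. apply cis_neq_0.
  - rewrite H. field. apply cis_neq_0.
Qed.

Lemma cis_minus (x y : R) : cis (x - y) = (cis x / cis y)%C.
Proof. unfold Rminus. rewrite cis_plus, cis_opp. reflexivity. Qed.

Lemma cis_double (x : R) : cis (2 * x) = (cis x * cis x)%C.
Proof. replace (2 * x) with (x + x) by ring. apply cis_plus. Qed.

Lemma cis_PI_minus (x : R) : cis (PI - x) = (- / cis x)%C.
Proof.
  rewrite cis_minus. replace (cis PI) with (- (1))%C.
  - field. apply cis_neq_0.
  - unfold cis, Copp, RtoC; cbn [fst snd]. rewrite cos_PI, sin_PI. f_equal; ring.
Qed.

(** Makes the segment lengths rational in [cis], so that the geometric identities become accessible
    to [field]. *)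
Lemma sin_sin_cis (x y : R) :
  RtoC (4 * sin x * sin y) = (- ((cis x - / cis x) * (cis y - / cis y)))%C.
Proof.
  rewrite <- !cis_opp.
  unfold cis, RtoC, Cmult, Cminus, Cplus, Copp; simpl. rewrite !cos_neg, !sin_neg.
  f_equal; ring.
Qed.

(** The sign is known only through [s * s = 1]: sines are later multiplied in pairs. *)
Lemma sin_shift (k : Z) :
  exists s : R, s * s = 1 /\ forall x, sin (x + IZR k * PI) = s * sin x.
Proof.
  induction k using Z.peano_ind.
  - exists 1. split; [ring|]. intros x. rewrite Rmult_0_l, Rplus_0_r. ring.
  - destruct IHk as [s [H1 H2]]. exists (- s). split; [lra|]. intros x.
    replace (x + IZR (Z.succ k) * PI) with (x + IZR k * PI + PI) by (rewrite succ_IZR; ring).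
    rewrite neg_sin, H2. ring.
  - destruct IHk as [s [H1 H2]]. exists (- s). split; [lra|]. intros x.
    replace (x + IZR (Z.pred k) * PI) with (x + IZR k * PI - PI)
      by (unfold Z.pred; rewrite plus_IZR; ring).
    rewrite <- (Ropp_involutive (sin _)), <- neg_sin.
    replace (x + IZR k * PI - PI + PI) with (x + IZR k * PI) by ring.
    rewrite H2. ring.
Qed.

(** * Transfer of the basic complex arithmetic to [C] *)

Definition toC (z : Cx) : C := (Re z, Im z).

Lemma toC_inj (z w : Cx) : toC z = toC w -> z = w.
Proof. destruct z, w; unfold toC; simpl. now intros [= -> ->]. Qed.

Lemma toC_add (z w : Cx) : toC (Cadd z w) = (toC z + toC w)%C.
Proof. reflexivity. Qed.

Lemma toC_mul (z w : Cx) : toC (Cmul z w) = (toC z * toC w)%C.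
Proof. reflexivity. Qed.

Lemma toC_sub (z w : Cx) : toC (Csub z w) = (toC z - toC w)%C.
Proof. reflexivity. Qed.

Lemma toC_scal (r : R) (z : Cx) : toC (Cscal r z) = (RtoC r * toC z)%C.
Proof. unfold toC, Cscal, Cmult, RtoC; simpl. f_equal; ring. Qed.

Lemma Cabs_toC (z : Cx) : Cabs z = Cmod (toC z).
Proof. unfold Cabs, Cnorm2, Cmod, toC; cbn [fst snd]. f_equal. ring. Qed.

Lemma step_of_interior (psi : V -> Cx) (v v1 v2 : V) (f : V -> R) :
  nondegenerate psi -> In (v1, v2) (inc_black v) -> interior_of psi v (v1, v2) ->
  step psi f v = (rate psi v v1 * f v1 + rate psi v v2 * f v2) / (rate psi v v1 + rate psi v v2).
Proof.
  intros (_ & _ & Hone) Hin Hint. specialize (Hone v). unfold step.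
  destruct v as [m n]. cbn [inc_black In map fold_right fst snd] in *.
  destruct Hin as [E|[E|[E|[]]]]; injection E as <- <-;
    repeat (destruct excluded_middle_informative); unfold exactly_one3 in Hone;
    try tauto; ring.
Qed.

(** * Normal form of the T-graph and geometry of its segments *)

Section Lattice.
Variables (a b c y0 : R).
Hypotheses (Ha : 0 < a) (Hb : 0 < b) (Hc : 0 < c) (Habc : a + b + c = PI).

Definition phase_at (v : V) : R := y0 + IZR (fst v) * c - IZR (snd v) * b.

Definition zeta (v : V) : C :=
  ((1 - cis (2 * c)) * IZR (fst v) + (1 - cis (- (2 * b))) * IZR (snd v)
   + cis (2 * phase_at v))%C.

Definition corrector (v : V) : C :=
  let e := cis (2 * phase_at v) in
  let p := cis (2 * c) in
  let q := cis (- (2 * b)) in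
  (e * e - (1 + p + q) * e - p * q / e)%C.

(** Signed positions along the line of a segment. The last equation says that [z^2 - g] is preserved
    in mean, with denominators cleared so that it makes sense before the signs of [s1] and [s2] are
    known. *)
Definition collinear_step (v v1 v2 : V) (s1 s2 : R) (u : C) : Prop :=
  Cmod u = 1 /\ zeta v1 = (zeta v + s1 * u)%C /\ zeta v2 = (zeta v + s2 * u)%C /\
  ((corrector v1 - corrector v) * s2 - (corrector v2 - corrector v) * s1
   = u * u * (s1 - s2) * s1 * s2)%C.

Lemma phase_shift (m n i j : Z) :
  phase_at ((m + i)%Z, (n + j)%Z) = phase_at (m, n) + IZR i * c - IZR j * b.
Proof. unfold phase_at; cbn [fst snd]. rewrite !plus_IZR. ring. Qed.

Lemma zeta_shift (m n i j : Z) :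
  zeta ((m + i)%Z, (n + j)%Z) =
  (zeta (m, n) + (1 - cis (2 * c)) * IZR i + (1 - cis (- (2 * b))) * IZR j
   + cis (2 * (phase_at (m, n) + IZR i * c - IZR j * b)) - cis (2 * phase_at (m, n)))%C.
Proof.
  unfold zeta. rewrite phase_shift. cbn [fst snd]. rewrite !plus_IZR, !RtoC_plus. ring.
Qed.

Lemma cis_a : cis a = (- / (cis b * cis c))%C.
Proof. replace a with (PI - (b + c)) by lra. now rewrite cis_PI_minus, cis_plus. Qed.

(** This and the next two lemmas treat the three black faces at a vertex. Once [a] is eliminated,
    each claim is a rational identity in [cis y], [cis b] and [cis c]. *)
Lemma collinear_c (m n : Z) :
  let y := phase_at (m, n) in
  collinear_step (m, n) ((m - 1)%Z, (n + 1)%Z) (m, (n + 1)%Z)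
    (4 * sin a * sin (y - c)) (4 * sin b * sin y) (cis (y - b)).
Proof.
  intros y. assert (Hw := cis_neq_0 y). assert (Hbb := cis_neq_0 b). assert (Hcc := cis_neq_0 c).
  unfold collinear_step. split; [apply Cmod_cis|].
  replace (m, (n + 1)%Z) with ((m + 0)%Z, (n + 1)%Z) by (f_equal; lia).
  replace (m - 1)%Z with (m + -1)%Z by lia.
  rewrite !zeta_shift. unfold corrector. rewrite !phase_shift. fold y.
  rewrite !sin_sin_cis.
  replace (2 * (y + -1 * c - 1 * b)) with (2 * (y - c - b)) by ring.
  replace (2 * (y + 0 * c - 1 * b)) with (2 * (y - b)) by ring.
  rewrite cis_a, !cis_opp, !cis_double, !cis_minus.
  set (w := cis y) in *. set (B := cis b) in *. set (G := cis c) in *.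
  repeat split; try (field; auto).
Qed.

Lemma collinear_a (m n : Z) :
  let y := phase_at (m, n) in
  collinear_step (m, n) (m, (n - 1)%Z) ((m - 1)%Z, n)
    (- (4 * sin b * sin (y + b))) (4 * sin c * sin (y - c)) (cis y).
Proof.
  intros y. assert (Hw := cis_neq_0 y). assert (Hbb := cis_neq_0 b). assert (Hcc := cis_neq_0 c).
  unfold collinear_step. split; [apply Cmod_cis|].
  replace (m, (n - 1)%Z) with ((m + 0)%Z, (n + -1)%Z) by (f_equal; lia).
  replace ((m - 1)%Z, n) with ((m + -1)%Z, (n + 0)%Z) by (f_equal; lia).
  rewrite !zeta_shift. unfold corrector. rewrite !phase_shift. fold y.
  rewrite !RtoC_opp, !sin_sin_cis.
  replace (2 * (y + 0 * c - -1 * b)) with (2 * (y + b)) by ring.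
  replace (2 * (y + -1 * c - 0 * b)) with (2 * (y - c)) by ring.
  rewrite !cis_opp, !cis_double, !cis_minus, !cis_plus.
  set (w := cis y) in *. set (B := cis b) in *. set (G := cis c) in *.
  repeat split; try (field; auto).
Qed.

Lemma collinear_b (m n : Z) :
  let y := phase_at (m, n) in
  collinear_step (m, n) ((m + 1)%Z, (n - 1)%Z) ((m + 1)%Z, n)
    (- (4 * sin a * sin (y + b))) (- (4 * sin c * sin y)) (cis (y + c)).
Proof.
  intros y. assert (Hw := cis_neq_0 y). assert (Hbb := cis_neq_0 b). assert (Hcc := cis_neq_0 c).
  unfold collinear_step. split; [apply Cmod_cis|].
  replace ((m + 1)%Z, n) with ((m + 1)%Z, (n + 0)%Z) by (f_equal; lia).
  replace (n - 1)%Z with (n + -1)%Z by lia.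
  rewrite !zeta_shift. unfold corrector. rewrite !phase_shift. fold y.
  rewrite !RtoC_opp, !sin_sin_cis.
  replace (2 * (y + 1 * c - -1 * b)) with (2 * (y + c + b)) by ring.
  replace (2 * (y + 1 * c - 0 * b)) with (2 * (y + c)) by ring.
  rewrite cis_a, !cis_opp, !cis_double, !cis_plus.
  set (w := cis y) in *. set (B := cis b) in *. set (G := cis c) in *.
  repeat split; try (field; auto).
Qed.

Lemma Cmod_corrector_le (v : V) : Cmod (corrector v) <= 5.
Proof.
  unfold corrector. set (e := cis (2 * phase_at v)). set (p := cis (2 * c)). set (q := cis (- (2 * b))).
  assert (He : Cmod e = 1) by apply Cmod_cis. assert (Hp : Cmod p = 1) by apply Cmod_cis.
  assert (Hq : Cmod q = 1) by apply Cmod_cis.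
  assert (He0 : e <> 0) by (apply Cmod_gt_0; lra).
  unfold Cminus.
  eapply Rle_trans; [apply Cmod_triangle|].
  assert (H1 := Cmod_triangle (e * e) (- ((1 + p + q) * e))).
  assert (H2 := Cmod_triangle (1 + p) q). assert (H3 := Cmod_triangle 1 p).
  rewrite !Cmod_opp, !Cmod_mult, ?He in *.
  rewrite Cmod_div, Cmod_mult, Hp, Hq, He in * by assumption.
  rewrite Cmod_1 in H3. lra.
Qed.

(** Up to a term of modulus 1, [zeta] is linear in [(m, n)] with determinant
    [d = 4 sin a sin b sin c > 0]; Cramer's rule bounds [m] and [n]. *)
Lemma zeta_sublevel_finite (r : R) :
  exists l : list V, forall v, Cmod (zeta v) <= r -> In v l.
Proof.
  assert (Hs : 0 < sin a /\ 0 < sin b /\ 0 < sin c)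
    by (repeat split; apply sin_gt_0; lra).
  set (d := 4 * sin b * sin c * sin a).
  assert (Hd : 0 < d) by (unfold d; repeat apply Rmult_lt_0_compat; lra).
  destruct (INR_unbounded (4 * (r + 1) / d)) as [N HN].
  assert (HNd : 4 * (r + 1) < INR N * d) by (apply Rlt_div_l; assumption).
  set (rng := map (fun k => (Z.of_nat k - Z.of_nat N)%Z) (seq 0 (2 * N + 1))).
  assert (Hrng : forall x : Z, Rabs (IZR x) * d <= 4 * (r + 1) -> In x rng).
  { intros x Hx.
    assert (Hlt : Rabs (IZR x) < INR N) by (apply Rmult_lt_reg_r with d; lra).
    rewrite <- abs_IZR, INR_IZR_INZ in Hlt. apply lt_IZR in Hlt.
    apply in_map_iff. exists (Z.to_nat (x + Z.of_nat N)). split; [lia|].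
    apply in_seq. lia. }
  exists (list_prod rng rng). intros [m n] Hv.
  set (X := 2 * (sin c * sin c) * IZR m + 2 * (sin b * sin b) * IZR n).
  set (Z0 := - (2 * sin c * cos c) * IZR m + 2 * sin b * cos b * IZR n).
  assert (Hz : zeta (m, n) = ((X, Z0) + cis (2 * phase_at (m, n)))%C).
  { unfold zeta. f_equal. unfold X, Z0, cis, Cminus, Cplus, Cmult, Copp, RtoC; cbn [fst snd].
    rewrite cos_neg, sin_neg, !cos_2a_sin, !sin_2a. f_equal; ring. }
  assert (HW : Cmod (X, Z0) <= r + 1).
  { replace (X, Z0) with (zeta (m, n) + - cis (2 * phase_at (m, n)))%C by (rewrite Hz; ring).
    eapply Rle_trans; [apply Cmod_triangle|]. rewrite Cmod_opp, Cmod_cis. lra. }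
  assert (HXY := Rmax_Cmod (X, Z0)). cbn [fst snd] in HXY.
  assert (HX : Rabs X <= r + 1) by (eapply Rle_trans; [apply (Rmax_l _ (Rabs Z0))|lra]).
  assert (HY : Rabs Z0 <= r + 1) by (eapply Rle_trans; [apply (Rmax_r (Rabs X))|lra]).
  assert (Hsa : sin a = sin b * cos c + cos b * sin c).
  { rewrite <- sin_plus. replace a with (PI - (b + c)) by lra. apply sin_PI_x. }
  assert (HdE : d = 4 * sin b * sin c * (sin b * cos c + cos b * sin c)) by (unfold d; now rewrite Hsa).
  assert (Hlin : forall A B, Rabs A <= 2 -> Rabs B <= 2 -> Rabs (A * X + B * Z0) <= 4 * (r + 1)).
  { intros A B HA HB. eapply Rle_trans; [apply Rabs_triang|]. rewrite !Rabs_mult.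
    replace (4 * (r + 1)) with (2 * (r + 1) + 2 * (r + 1)) by ring.
    apply Rplus_le_compat; apply Rmult_le_compat; auto using Rabs_pos. }
  assert (Hsq : forall x, Rabs (2 * (sin x * sin x)) <= 2 /\ Rabs (2 * sin x * cos x) <= 2).
  { intros x. assert (Hx := sin2_cos2 x). unfold Rsqr in Hx.
    assert (H1 := Rle_0_sqr (sin x - cos x)). assert (H2 := Rle_0_sqr (sin x + cos x)).
    unfold Rsqr in *. split; apply Rabs_le; nra. }
  apply in_prod; apply Hrng;
    rewrite <- (Rabs_right d) at 1 by lra; rewrite <- Rabs_mult.
  - replace (IZR m * d) with (2 * sin b * cos b * X + - (2 * (sin b * sin b)) * Z0)
      by (rewrite HdE; unfold X, Z0; ring).
    apply Hlin; [|rewrite Rabs_Ropp]; apply Hsq.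
  - replace (IZR n * d) with (2 * sin c * cos c * X + 2 * (sin c * sin c) * Z0)
      by (rewrite HdE; unfold X, Z0; ring).
    apply Hlin; apply Hsq.
Qed.

(** * The walk on a nondegenerate affine image of [zeta] *)

Section Walk.
Variables (psi : V -> Cx) (K0 kappa : C).
Hypotheses (Hkappa : kappa <> 0) (Hpsi : forall v, toC (psi v) = (K0 + kappa * zeta v)%C)
  (Hnd : nondegenerate psi).

(** The white triangle at [v] has edges proportional to [1 - cis (2 * phase_at v)], so it would
    collapse to a point. *)
Lemma sin_phase_neq_0 (v : V) : sin (phase_at v) <> 0.
Proof.
  intros Hs. destruct v as [m n]. destruct Hnd as [Hwhite _]. apply (Hwhite m n).
  assert (He : cis (2 * phase_at (m, n)) = 1).
  { unfold cis. rewrite cos_2a_sin, sin_2a, Hs. unfold RtoC. f_equal; ring. }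
  split; apply toC_inj; rewrite !Hpsi; f_equal; f_equal.
  - replace ((m + 1)%Z, n) with ((m + 1)%Z, (n + 0)%Z) by (f_equal; lia).
    rewrite zeta_shift.
    replace (2 * (phase_at (m, n) + 1 * c - 0 * b)) with (2 * phase_at (m, n) + 2 * c) by ring.
    rewrite cis_plus, He. ring.
  - replace (m, (n + 1)%Z) with ((m + 0)%Z, (n + 1)%Z) by (f_equal; lia).
    rewrite zeta_shift.
    replace (2 * (phase_at (m, n) + 0 * c - 1 * b)) with (2 * phase_at (m, n) + - (2 * b)) by ring.
    rewrite cis_plus, He. ring.
Qed.

Lemma collinear_interior (v v1 v2 : V) (s1 s2 : R) (u : C) :
  collinear_step v v1 v2 s1 s2 u -> s1 * s2 < 0 -> interior_of psi v (v1, v2).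
Proof.
  intros (Hu & H1 & H2 & _) Hs. unfold interior_of, strictly_between; cbn [fst snd].
  assert (Hu0 : u <> 0) by (apply Cmod_gt_0; lra).
  assert (Hne : s1 - s2 <> 0) by nra.
  split.
  - intros E. apply (f_equal toC) in E. rewrite !Hpsi, H1, H2 in E.
    apply Hne. apply RtoC_inj.
    transitivity ((K0 + kappa * (zeta v + s1 * u) - (K0 + kappa * (zeta v + s2 * u))) / (kappa * u))%C.
    + rewrite RtoC_minus. field. auto.
    + rewrite E. field. auto.
  - exists (s1 / (s1 - s2)). split.
    + destruct (Rlt_dec s1 0).
      * assert (0 < s2) by nra.
        replace (s1 / (s1 - s2)) with (- s1 / (s2 - s1)) by (field; lra).
        split; [apply Rdiv_lt_0_compat|apply Rlt_div_l]; lra.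
      * assert (0 < s1) by nra. assert (s2 < 0) by nra.
        split; [apply Rdiv_lt_0_compat|apply Rlt_div_l]; lra.
    + apply toC_inj. rewrite toC_add, !toC_scal, !Hpsi, H1, H2.
      rewrite RtoC_minus, !RtoC_div, RtoC_minus by assumption.
      field. intros E. apply Hne. apply RtoC_inj. now rewrite RtoC_minus.
Qed.

Lemma rate_collinear (v w : V) (s : R) (u : C) :
  Cmod u = 1 -> zeta w = (zeta v + s * u)%C -> rate psi v w = / (Cmod kappa * Rabs s).
Proof.
  intros Hu H. unfold rate. rewrite Cabs_toC, toC_sub, !Hpsi, H.
  replace (K0 + kappa * (zeta v + s * u) - (K0 + kappa * zeta v))%C with (kappa * (s * u))%C by ring.
  rewrite !Cmod_mult, Cmod_R, Hu, Rmult_1_r. reflexivity.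
Qed.

Definition min_sin : R := Rmin (sin a) (Rmin (sin b) (sin c)).

(** The data required by [lyap_superharmonic]. Rates are inverse to lengths, so the jump to [v1], at
    distance [p], has probability [m / (p + m)]. *)
Definition good_step (v v1 v2 : V) : Prop :=
  exists (p m : R) (u : C),
    Cmod u = 1 /\ 0 < p <= 4 /\ 0 < m <= 4 /\ 4 * min_sin * min_sin <= p + m /\
    zeta v1 = (zeta v + p * u)%C /\ zeta v2 = (zeta v - m * u)%C /\
    ((corrector v1 - corrector v) / p + (corrector v2 - corrector v) / m = u * u * (p + m))%C /\
    forall f, step psi f v = m / (p + m) * f v1 + (1 - m / (p + m)) * f v2.

Lemma good_step_walk (v v1 v2 : V) : good_step v v1 v2 -> exists t, walk_step psi v v1 v2 t.
Proof.
  intros (p & m & u & _ & Hp & Hm & _ & _ & _ & _ & Hstep).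
  exists (m / (p + m)). split; [|exact Hstep].
  split; [apply Rdiv_lt_0_compat|apply Rlt_div_l]; lra.
Qed.

Lemma good_step_of_collinear (v v1 v2 : V) (s1 s2 : R) (u : C) :
  In (v1, v2) (inc_black v) ->
  collinear_step v v1 v2 s1 s2 u -> s1 * s2 < 0 -> Rabs s1 <= 4 -> Rabs s2 <= 4 ->
  4 * min_sin * min_sin <= Rabs s1 + Rabs s2 -> good_step v v1 v2.
Proof.
  intros Hin Hcol Hs H1 H2 Hl.
  assert (Hint := collinear_interior _ _ _ _ _ _ Hcol Hs).
  destruct Hcol as (Hu & Hz1 & Hz2 & Hg).
  assert (Hs1 : s1 <> 0) by nra. assert (Hs2 : s2 <> 0) by nra.
  assert (Ha1 : 0 < Rabs s1) by (now apply Rabs_pos_lt).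
  assert (Ha2 : 0 < Rabs s2) by (now apply Rabs_pos_lt).
  assert (Hk : 0 < Cmod kappa) by (now apply Cmod_gt_0).
  assert (HC1 : RtoC s1 <> 0) by (intros E; apply Hs1, RtoC_inj, E).
  assert (HC2 : RtoC s2 <> 0) by (intros E; apply Hs2, RtoC_inj, E).
  assert (Hg' : ((corrector v1 - corrector v) / s1 - (corrector v2 - corrector v) / s2
                 = u * u * (s1 - s2))%C).
  { transitivity (((corrector v1 - corrector v) * s2 - (corrector v2 - corrector v) * s1) / (s1 * s2))%C.
    - field. auto.
    - rewrite Hg. field. auto. }
  assert (Hstep : forall f, step psi f v =
     Rabs s2 / (Rabs s1 + Rabs s2) * f v1 + (1 - Rabs s2 / (Rabs s1 + Rabs s2)) * f v2).
  { intros f. rewrite (step_of_interior psi v v1 v2 f Hnd Hin Hint).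
    rewrite (rate_collinear _ _ _ _ Hu Hz1), (rate_collinear _ _ _ _ Hu Hz2).
    field. repeat split; nra. }
  (* If [s1 < 0] the direction [u] is reversed, so that [v1] is always on the positive side. *)
  destruct (Rlt_dec s1 0) as [Hneg|Hpos].
  - assert (0 < s2) by nra.
    exists (Rabs s1), (Rabs s2), (- u)%C.
    rewrite Cmod_opp. do 4 (split; [lra|]).
    rewrite (Rabs_left s1) in * by lra. rewrite (Rabs_right s2) in * by lra.
    rewrite RtoC_opp.
    repeat split; auto.
    + rewrite Hz1. ring.
    + rewrite Hz2. ring.
    + transitivity (- ((corrector v1 - corrector v) / s1 - (corrector v2 - corrector v) / s2))%C.
      * field. auto.
      * rewrite Hg'. ring.
  - assert (0 < s1) by lra. assert (s2 < 0) by nra.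
    exists (Rabs s1), (Rabs s2), u.
    do 4 (split; [lra|]).
    rewrite (Rabs_right s1) in * by lra. rewrite (Rabs_left s2) in * by lra.
    rewrite RtoC_opp.
    repeat split; auto.
    + rewrite Hz2. ring.
    + transitivity ((corrector v1 - corrector v) / s1 - (corrector v2 - corrector v) / s2)%C.
      * field. auto.
      * rewrite Hg'. ring.
Qed.

Lemma min_sin_bounds : 0 < min_sin /\ min_sin <= sin a /\ min_sin <= sin b /\ min_sin <= sin c.
Proof.
  assert (0 < sin a /\ 0 < sin b /\ 0 < sin c) by (repeat split; apply sin_gt_0; lra).
  unfold min_sin. repeat split.
  - repeat apply Rmin_glb_lt; lra.
  - apply Rmin_l.
  - eapply Rle_trans; [apply Rmin_r|apply Rmin_l].
  - eapply Rle_trans; [apply Rmin_r|apply Rmin_r].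
Qed.

Lemma Rabs_sin_le_1 (x : R) : Rabs (sin x) <= 1.
Proof. apply Rabs_le. destruct (SIN_bound x). lra. Qed.

Lemma Rabs_4_sin_sin_le (x y : R) : Rabs (4 * sin x * sin y) <= 4.
Proof.
  rewrite !Rabs_mult, (Rabs_right 4) by lra.
  assert (H1 := Rabs_sin_le_1 x). assert (H2 := Rabs_sin_le_1 y).
  assert (H3 := Rabs_pos (sin x)). assert (H4 := Rabs_pos (sin y)). nra.
Qed.

Lemma sin_minus_le (x y : R) : sin (x - y) <= Rabs (sin x) + Rabs (sin y).
Proof.
  rewrite sin_minus. assert (H1 := COS_bound x). assert (H2 := COS_bound y).
  assert (H3 := Rle_abs (sin x)). assert (H4 := Rle_abs (- sin x)).
  assert (H5 := Rle_abs (sin y)). assert (H6 := Rle_abs (- sin y)).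
  rewrite Rabs_Ropp in H4, H6. nra.
Qed.

(** Both sines cannot be small at once, since [sin (x - y) <= |sin x| + |sin y|]; in the
    applications [sin (x - y)] is the sine of an angle of the triangle. *)
Lemma segment_length_ge (s t x y : R) :
  min_sin <= sin s -> min_sin <= sin t -> min_sin <= sin (x - y) ->
  4 * min_sin * min_sin <= Rabs (4 * sin s * sin x) + Rabs (4 * sin t * sin y).
Proof.
  intros Hs Ht Hxy. destruct min_sin_bounds as [H0 _].
  assert (H := sin_minus_le x y).
  rewrite !Rabs_mult, !(Rabs_right 4), (Rabs_right (sin s)), (Rabs_right (sin t)) by lra.
  assert (H1 := Rabs_pos (sin x)). assert (H2 := Rabs_pos (sin y)). nra.
Qed.

(** For such phases [sin (y - c)] and [sin y] have opposite signs, so [v] separates the other two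
    vertices of this face; [good_a] and [good_b] are analogous. *)
Lemma good_c (m n k : Z) :
  0 < phase_at (m, n) - IZR k * PI < c ->
  good_step (m, n) ((m - 1)%Z, (n + 1)%Z) (m, (n + 1)%Z).
Proof.
  intros H. set (y := phase_at (m, n)) in *.
  assert (Hsin : 0 < sin a /\ 0 < sin b /\ 0 < sin c) by (repeat split; apply sin_gt_0; lra).
  destruct min_sin_bounds as (_ & Hma & Hmb & Hmc).
  refine (good_step_of_collinear _ _ _ _ _ _ _ (collinear_c m n) _ _ _ _); fold y.
  - simpl; auto.
  - destruct (sin_shift k) as [s [Hs E]].
    replace y with (y - IZR k * PI + IZR k * PI) at 2 by ring.
    replace (y - c) with (y - IZR k * PI - c + IZR k * PI) by ring. rewrite !E.
    set (x := y - IZR k * PI) in *.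
    assert (0 < sin x) by (apply sin_gt_0; lra).
    assert (0 < sin (c - x)) by (apply sin_gt_0; lra).
    replace (x - c) with (- (c - x)) by ring. rewrite sin_neg.
    replace (4 * sin a * (s * - sin (c - x)) * (4 * sin b * (s * sin x)))
      with (- (16 * (s * s) * (sin a * sin b * (sin (c - x) * sin x)))) by ring.
    rewrite Hs. assert (0 < sin a * sin b * (sin (c - x) * sin x)) by (repeat apply Rmult_lt_0_compat; lra).
    lra.
  - apply Rabs_4_sin_sin_le.
  - apply Rabs_4_sin_sin_le.
  - rewrite Rplus_comm. apply segment_length_ge; auto.
    replace (y - (y - c)) with c by ring. exact Hmc.
Qed.

Lemma good_a (m n k : Z) :
  c < phase_at (m, n) - IZR k * PI < c + a ->
  good_step (m, n) (m, (n - 1)%Z) ((m - 1)%Z, n).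
Proof.
  intros H. set (y := phase_at (m, n)) in *.
  assert (Hsin : 0 < sin a /\ 0 < sin b /\ 0 < sin c) by (repeat split; apply sin_gt_0; lra).
  destruct min_sin_bounds as (_ & Hma & Hmb & Hmc).
  refine (good_step_of_collinear _ _ _ _ _ _ _ (collinear_a m n) _ _ _ _); fold y.
  - simpl; auto.
  - destruct (sin_shift k) as [s [Hs E]].
    replace (y + b) with (y - IZR k * PI + b + IZR k * PI) by ring.
    replace (y - c) with (y - IZR k * PI - c + IZR k * PI) by ring. rewrite !E.
    set (x := y - IZR k * PI) in *.
    assert (0 < sin (x + b)) by (apply sin_gt_0; lra).
    assert (0 < sin (x - c)) by (apply sin_gt_0; lra).
    replace (- (4 * sin b * (s * sin (x + b))) * (4 * sin c * (s * sin (x - c))))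
      with (- (16 * (s * s) * (sin b * sin c * (sin (x + b) * sin (x - c))))) by ring.
    rewrite Hs. assert (0 < sin b * sin c * (sin (x + b) * sin (x - c))) by (repeat apply Rmult_lt_0_compat; lra).
    lra.
  - rewrite Rabs_Ropp. apply Rabs_4_sin_sin_le.
  - apply Rabs_4_sin_sin_le.
  - rewrite Rabs_Ropp. apply segment_length_ge; auto.
    replace (y + b - (y - c)) with (PI - a) by lra. now rewrite sin_PI_x.
Qed.

Lemma good_b (m n k : Z) :
  c + a < phase_at (m, n) - IZR k * PI < PI ->
  good_step (m, n) ((m + 1)%Z, (n - 1)%Z) ((m + 1)%Z, n).
Proof.
  intros H. set (y := phase_at (m, n)) in *.
  assert (Hsin : 0 < sin a /\ 0 < sin b /\ 0 < sin c) by (repeat split; apply sin_gt_0; lra).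
  destruct min_sin_bounds as (_ & Hma & Hmb & Hmc).
  refine (good_step_of_collinear _ _ _ _ _ _ _ (collinear_b m n) _ _ _ _); fold y.
  - simpl; auto.
  - destruct (sin_shift k) as [s [Hs E]].
    replace (y + b) with (y - IZR k * PI + b + IZR k * PI) by ring.
    replace y with (y - IZR k * PI + IZR k * PI) at 2 by ring. rewrite !E.
    set (x := y - IZR k * PI) in *.
    assert (0 < sin x) by (apply sin_gt_0; lra).
    assert (0 < sin (x + b - PI)) by (apply sin_gt_0; lra).
    replace (x + b) with (x + b - PI + PI) by ring. rewrite neg_sin.
    replace (- (4 * sin a * (s * - sin (x + b - PI))) * - (4 * sin c * (s * sin x)))
      with (- (16 * (s * s) * (sin a * sin c * (sin (x + b - PI) * sin x)))) by ring.
    rewrite Hs. assert (0 < sin a * sin c * (sin (x + b - PI) * sin x)) by (repeat apply Rmult_lt_0_compat; lra).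
    lra.
  - rewrite Rabs_Ropp. apply Rabs_4_sin_sin_le.
  - rewrite Rabs_Ropp. apply Rabs_4_sin_sin_le.
  - rewrite !Rabs_Ropp. apply segment_length_ge; auto.
    replace (y + b - y) with b by ring. exact Hmb.
Qed.

Lemma phase_avoids : phase_avoids_multiples a b c y0.
Proof.
  intros i j k E. apply (sin_phase_neq_0 (i, (- j)%Z)).
  replace (phase_at (i, (- j)%Z)) with (0 + IZR k * PI).
  - destruct (sin_shift k) as [s [_ Hs]]. rewrite Hs, sin_0. ring.
  - rewrite <- Habc, Rplus_0_l, <- E. unfold phase_at; cbn [fst snd]. rewrite opp_IZR. ring.
Qed.

Lemma good_step_exists (v : V) : exists v1 v2, good_step v v1 v2.
Proof.
  destruct v as [m n].
  destruct (phase_classify a b c y0 Ha Hb Hc phase_avoids m (- n)%Z) as [k Hk].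
  assert (E : y0 + IZR m * c + IZR (- n) * b - IZR k * (a + b + c) = phase_at (m, n) - IZR k * PI).
  { rewrite Habc, opp_IZR. unfold phase_at; cbn [fst snd]. ring. }
  cbv zeta in Hk. rewrite E, Habc in Hk. destruct Hk as [Hk|[Hk|Hk]].
  - do 2 eexists. exact (good_c m n k Hk).
  - do 2 eexists. exact (good_a m n k Hk).
  - do 2 eexists. exact (good_b m n k Hk).
Qed.

Lemma walk_irreducible : irreducible psi.
Proof.
  intros S HS [m0 n0] [m n] H0.
  assert (Hg : forall x y1 y2, good_step x y1 y2 -> S x -> S y1 /\ S y2).
  { intros x y1 y2 Hx. destruct (good_step_walk x y1 y2 Hx) as [t Ht]. exact (HS x y1 y2 t Ht). }
  (* The second coordinate is negated because [phase_at] decreases by [b] along it. *)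
  set (S' := fun i j : Z => S (i, (- j)%Z)).
  assert (Hcl : closed_under_moves a b c y0 S').
  { intros i j k H X. unfold S' in *.
    assert (E : X = phase_at (i, (- j)%Z) - IZR k * PI).
    { unfold X. rewrite Habc. unfold phase_at; cbn [fst snd]. rewrite opp_IZR. ring. }
    rewrite E, Habc.
    replace (- (j - 1))%Z with (- j + 1)%Z by lia.
    replace (- (j + 1))%Z with (- j - 1)%Z by lia.
    split; [|split]; intros HX.
    - exact (Hg _ _ _ (good_c _ _ k HX) H).
    - exact (Hg _ _ _ (good_a _ _ k HX) H).
    - destruct (Hg _ _ _ (good_b _ _ k HX) H). split; assumption. }
  assert (HT := closed_everything_any a b c y0 Ha Hb Hc phase_avoids S' Hcl m0 (- n0)%Z m (- n)%Z).
  unfold S' in HT. rewrite !Z.opp_involutive in HT. exact (HT H0).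
Qed.

(** Outside the unit disc all terms but the logarithm are bounded, so the Lyapunov function tends to
    infinity. *)
Lemma lyap_ge (M g0 : R) (z g : C) :
  0 <= M -> 0 <= g0 -> Cmod g <= g0 -> 1 <= Cmod z ->
  ln (Cmod z) - M - g0 * (1 / 2 + 3 / 4 * M) <= lyap M z g.
Proof.
  intros HM Hg0 Hg Hz. unfold lyap.
  assert (Hi : 0 < / Cmod z <= 1).
  { split; [apply Rinv_0_lt_compat; lra|]. rewrite <- Rinv_1. apply Rinv_le_contravar; lra. }
  assert (Hd : 0 <= M / Cmod z <= M) by (unfold Rdiv; split; nra).
  assert (Hz0 : z <> 0) by (apply Cmod_gt_0; lra).
  assert (Hf : Rabs (fst (g / (z * z))%C) <= g0).
  { eapply Rle_trans; [apply (re_le_Cmod (g / (z * z))%C)|].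
    rewrite Cmod_div, Cmod_mult by (now apply Cmult_neq_0).
    apply Rle_div_l; [nra|].
    assert (1 <= Cmod z * Cmod z) by nra.
    assert (g0 * 1 <= g0 * (Cmod z * Cmod z)) by (apply Rmult_le_compat_l; lra). lra. }
  apply Rabs_le_between in Hf.
  assert (- (g0 * (1 / 2 + 3 / 4 * M)) <= fst (g / (z * z))%C * (1 / 2 + 3 / 4 * (M / Cmod z))).
  { set (A := fst (g / (z * z))%C) in *. set (B := M / Cmod z) in *.
    assert (- g0 * (1 / 2 + 3 / 4 * B) <= A * (1 / 2 + 3 / 4 * B)) by (apply Rmult_le_compat_r; lra).
    assert (g0 * B <= g0 * M) by (apply Rmult_le_compat_l; lra). lra. }
  lra.
Qed.

Theorem walk_recurrent : recurrent psi.
Proof.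
  destruct min_sin_bounds as [Hms _].
  (* In the coordinates [zeta], 5 bounds the corrector, 4 the distance to either endpoint, and the
     last number bounds segment lengths from below. *)
  destruct (lyap_superharmonic 5 4 (4 * min_sin * min_sin)) as (M & r & HM & Hr & Hlyap);
    [nra|lra|lra|].
  destruct (zeta_sublevel_finite r) as [F HF].
  apply (recurrent_of_lyapunov psi) with (h := fun v => lyap M (zeta v) (corrector v)) (F := F).
  - intros x. destruct (good_step_exists x) as (v1 & v2 & Hg).
    destruct (good_step_walk _ _ _ Hg) as [t Ht]. eauto.
  - intros K. destruct (zeta_sublevel_finite (Rmax 1 (exp (K + M + 5 * (1 / 2 + 3 / 4 * M))))) as [l Hl].
    exists l. intros x Hx. apply Hl.
    destruct (Rle_dec (Cmod (zeta x)) 1) as [H1|H1].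
    + eapply Rle_trans; [exact H1|apply Rmax_l].
    + eapply Rle_trans; [|apply Rmax_r].
      assert (H := lyap_ge M 5 (zeta x) (corrector x) HM ltac:(lra) (Cmod_corrector_le x) ltac:(lra)).
      rewrite <- (exp_ln (Cmod (zeta x))) by lra.
      destruct (Rle_lt_or_eq_dec (ln (Cmod (zeta x))) (K + M + 5 * (1 / 2 + 3 / 4 * M))) as [Hlt|Heq];
        [lra| |rewrite Heq; lra].
      left. now apply exp_increasing.
  - intros x Hx. destruct (good_step_exists x) as
      (v1 & v2 & p & m & u & Hu & Hp & Hm & Hl & H1 & H2 & Hg & Hstep).
    assert (Hbig : r <= Cmod (zeta x)).
    { apply Rnot_lt_le. intros Hlt. apply Hx, HF. lra. }
    assert (H := Hlyap (zeta x) (corrector x) (corrector v1) (corrector v2) u p m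
      (Cmod_corrector_le v1) (Cmod_corrector_le v2) Hu Hp Hm Hl Hg Hbig).
    rewrite <- H1, <- H2 in H. rewrite Hstep.
    set (h0 := lyap M (zeta x) (corrector x)) in *.
    set (h1 := lyap M (zeta v1) (corrector v1)) in *.
    set (h2 := lyap M (zeta v2) (corrector v2)) in *.
    (* The mean increment is the rate-weighted sum divided by the total rate [1 / p + 1 / m]. *)
    assert (E : m / (p + m) * h1 + (1 - m / (p + m)) * h2 - h0
                = ((h1 - h0) / p + (h2 - h0) / m) * (p * m / (p + m))) by (field; lra).
    assert (0 < p * m / (p + m)) by (apply Rdiv_lt_0_compat; [apply Rmult_lt_0_compat|]; lra).
    nra.
  - apply walk_irreducible.
Qed.

End Walk.
End Lattice.

(** * Polar form of unit complex numbers *)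

Lemma Cexpi_mul (x y : R) : Cmul (Cexpi x) (Cexpi y) = Cexpi (x + y).
Proof. apply toC_inj. symmetry. apply cis_plus. Qed.

Lemma Cexpi_conj (x : R) : Cconj (Cexpi x) = Cexpi (- x).
Proof. unfold Cconj, Cexpi; simpl. now rewrite cos_neg, sin_neg. Qed.

Lemma Cexpi_norm2 (x : R) : Cnorm2 (Cexpi x) = 1.
Proof. unfold Cnorm2, Cexpi; simpl. rewrite <- (sin2_cos2 x). unfold Rsqr. ring. Qed.

Lemma Cexpi_inv (x : R) : Cinv (Cexpi x) = Cexpi (- x).
Proof.
  unfold Cinv. rewrite Cexpi_norm2, Cexpi_conj, Rinv_1.
  unfold Cscal, Cexpi; simpl. f_equal; ring.
Qed.

Lemma Cpow_Cexpi (x : R) (n : nat) : Cpow (Cexpi x) n = Cexpi (INR n * x).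
Proof.
  induction n as [|n IH].
  - unfold Cexpi. simpl. rewrite Rmult_0_l, cos_0, sin_0. reflexivity.
  - cbn [Cpow]. rewrite IH, Cexpi_mul, S_INR. f_equal. ring.
Qed.

Lemma Cpowz_Cexpi (x : R) (k : Z) : Cpowz (Cexpi x) k = Cexpi (IZR k * x).
Proof.
  unfold Cpowz. destruct (Z.leb_spec 0 k).
  - now rewrite Cpow_Cexpi, INR_IZR_INZ, Z2Nat.id by assumption.
  - rewrite Cexpi_inv, Cpow_Cexpi, INR_IZR_INZ, Z2Nat.id, opp_IZR by lia. f_equal. ring.
Qed.

(** [Cdir2 d] is the factor in the reflection [z -> Cdir2 d * conj z] across the line of direction
    [d]. *)
Lemma Cdir2_polar (r t : R) : r <> 0 -> Cdir2 (Cscal r (Cexpi t)) = Cexpi (2 * t).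
Proof.
  intros Hr. replace (2 * t) with (t + t) by ring. rewrite <- Cexpi_mul.
  assert (H := Cexpi_norm2 t). unfold Cdir2, Cscal, Cmul, Cnorm2, Cexpi in *; cbn [Re Im] in *.
  replace (r * cos t * (r * cos t) + r * sin t * (r * sin t))
    with (r * r * (cos t * cos t + sin t * sin t)) by ring.
  rewrite H. f_equal; field; assumption.
Qed.

Lemma unit_Cexpi (z : Cx) : Cabs z = 1 -> exists t : R, z = Cexpi t.
Proof.
  intros H.
  assert (Hn : Re z * Re z + Im z * Im z = 1).
  { unfold Cabs, Cnorm2 in H. rewrite <- (sqrt_def (Re z * Re z + Im z * Im z)) by nra.
    rewrite H. ring. }
  assert (Hr : -1 <= Re z <= 1) by nra.
  assert (Hs : sqrt (1 - (Re z)²) = Rabs (Im z)).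
  { rewrite <- sqrt_Rsqr_abs. f_equal. unfold Rsqr. lra. }
  destruct z as [x y]; cbn [Re Im] in *.
  destruct (Rle_dec 0 y).
  - exists (acos x). unfold Cexpi. rewrite cos_acos, sin_acos, Hs by assumption.
    rewrite Rabs_right by lra. reflexivity.
  - exists (- acos x). unfold Cexpi. rewrite cos_neg, sin_neg, cos_acos, sin_acos, Hs by assumption.
    rewrite Rabs_left by lra. f_equal. ring.
Qed.

(** * Reduction of [psi] to the normal form [zeta] *)

Section Angles.
Variables (pa pb pc : R).
Hypotheses (Hpa : 0 < pa < 1) (Hpb : 0 < pb < 1) (Hpc : 0 < pc < 1) (Hsum : pa + pb + pc = 1).
Let a := PI * pa.
Let b := PI * pb.
Let c := PI * pc.

Lemma angles_pos : 0 < a /\ 0 < b /\ 0 < c.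
Proof. assert (H := PI_RGT_0). unfold a, b, c. repeat split; apply Rmult_lt_0_compat; lra. Qed.

Lemma angles_sum : a + b + c = PI.
Proof. unfold a, b, c. rewrite <- !Rmult_plus_distr_l, Hsum. ring. Qed.

Lemma sin_angles_pos : 0 < sin a /\ 0 < sin b /\ 0 < sin c.
Proof.
  assert (Hs := angles_sum). destruct angles_pos as (? & ? & ?).
  repeat split; apply sin_gt_0; lra.
Qed.

(** The length comes from the law of sines, the direction from the exterior angle [PI - b = a + c]
    at the vertex A. *)
Lemma DeltaB_minus_A :
  Csub (DeltaB pa pb pc) DeltaA = Cscal (sin a / sin c) (Cexpi (a + c)).
Proof.
  destruct sin_angles_pos as (_ & _ & Hc). assert (H := angles_sum).
  assert (Hb : sin b = sin (a + c)) by (replace b with (PI - (a + c)) by lra; apply sin_PI_x).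
  unfold Csub, Cadd, Cneg, DeltaB, DeltaA, C1, Cscal, Cexpi; cbn [Re Im]. fold a b c.
  rewrite Hb. f_equal.
  - rewrite cos_plus, sin_plus.
    apply (Rmult_eq_reg_r (sin c)); [|lra].
    assert (Hsq := sin2_cos2 a). unfold Rsqr in Hsq.
    field_simplify; [|lra|lra].
    replace (cos a ^ 2) with (1 - sin a * sin a) by (rewrite <- Hsq; ring). ring.
  - field. lra.
Qed.

(** Two successive reflections compose to a rotation by twice the angle between the edges: [2 c] for
    [rho1], and [2 (a + c)], that is [- 2 b] modulo [2 PI], for [rho2]. *)
Lemma eta_polar (m n : Z) : eta pa pb pc m n = Cexpi (IZR m * (2 * c) - IZR n * (2 * b)).
Proof.
  destruct sin_angles_pos as (Ha & Hb & Hc). assert (H := angles_sum).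
  assert (E1 : Cdir2 (Csub (DeltaB pa pb pc) DeltaA) = Cexpi (2 * (a + c))).
  { rewrite DeltaB_minus_A. apply Cdir2_polar.
    apply Rgt_not_eq, Rdiv_lt_0_compat; assumption. }
  assert (E2 : Cdir2 (DeltaB pa pb pc) = Cexpi (2 * a)).
  { apply Cdir2_polar. apply Rgt_not_eq, Rdiv_lt_0_compat; assumption. }
  assert (E3 : Cdir2 DeltaA = Cexpi 0).
  { unfold Cdir2, DeltaA, C1, Cnorm2, Cmul, Cscal, Cexpi; cbn [Re Im].
    rewrite cos_0, sin_0. f_equal; field. }
  assert (R1 : rho1 pa pb pc = Cexpi (2 * c)).
  { unfold rho1. rewrite E1, E2, Cexpi_conj, Cexpi_mul. f_equal. ring. }
  assert (R2 : rho2 pa pb pc = Cexpi (- (2 * b))).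
  { unfold rho2. rewrite E1, E3, Cexpi_conj, Cexpi_mul.
    replace (2 * (a + c) + - 0) with (- (2 * b) + 2 * PI) by lra.
    unfold Cexpi. now rewrite cos_plus, sin_plus, cos_2PI, sin_2PI, !Rmult_0_r, !Rmult_1_r, Rminus_0_r, Rplus_0_r. }
  unfold eta. rewrite R1, R2, !Cpowz_Cexpi, Cexpi_mul. f_equal. ring.
Qed.

Lemma one_minus_cis_neq_0 : (1 - cis (2 * c))%C <> 0.
Proof.
  destruct sin_angles_pos as (_ & _ & Hc). intros E.
  apply (f_equal fst) in E. unfold cis, Cminus, Cplus, Copp, RtoC in E; cbn [fst snd] in E.
  rewrite cos_2a_sin in E. nra.
Qed.

(** Scaled by [1 - P], the reference triangle has edges [1 - P] and [1 - Q] from the origin, the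
    coefficients in [zeta]; hence the choice of [kappa] below. *)
Lemma toC_DeltaB :
  toC (DeltaB pa pb pc) = ((1 - cis (- (2 * b))) / (1 - cis (2 * c)))%C.
Proof.
  destruct sin_angles_pos as (Ha & Hb & Hc). assert (H := angles_sum).
  assert (Hn := one_minus_cis_neq_0).
  unfold DeltaB. fold a b c. rewrite toC_scal. change (toC (Cexpi a)) with (cis a).
  replace (sin b / sin c) with (4 * sin b * sin c * / (4 * sin c * sin c)) by (field; lra).
  rewrite RtoC_mult, RtoC_inv by (apply Rgt_not_eq; repeat apply Rmult_lt_0_compat; lra).
  rewrite !sin_sin_cis.
  rewrite (cis_a a b c H), cis_opp, !cis_double in *.
  assert (HB := cis_neq_0 b). assert (HG := cis_neq_0 c).
  set (B := cis b) in *. set (G := cis c) in *.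
  assert (HG2 : (G * G - 1)%C <> 0).
  { intros E. apply Hn. replace (1 - G * G)%C with (- (G * G - 1))%C by ring. rewrite E. ring. }
  field. repeat split; auto.
Qed.

(** The difference [psi - kappa * zeta] has zero increments in both lattice directions, hence is
    constant. *)
Lemma psi_affine_zeta (lam : Cx) (psi : V -> Cx) :
  Cabs lam = 1 -> is_psi pa pb pc lam psi ->
  exists (y0 : R) (k0 kappa : C), kappa <> 0 /\
    forall v, toC (psi v) = (k0 + kappa * zeta b c y0 v)%C.
Proof.
  intros Hlam Hpsi. destruct (unit_Cexpi lam Hlam) as [t ->].
  assert (Hn := one_minus_cis_neq_0).
  (* The shift by [PI] realises the minus sign in [lam * eta = - exp (2 i y)]. *)
  set (y0 := (t - PI) / 2). set (kappa := (/ (1 - cis (2 * c)))%C).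
  set (D := fun v => (toC (psi v) - kappa * zeta b c y0 v)%C).
  assert (Heta : forall m n, toC (Cadd C1 (Cmul (Cexpi t) (eta pa pb pc m n)))
                  = (1 - cis (2 * phase_at b c y0 (m, n)))%C).
  { intros m n. rewrite eta_polar, Cexpi_mul, toC_add. change (toC C1) with (RtoC 1).
    change (toC (Cexpi (t + (IZR m * (2 * c) - IZR n * (2 * b)))))
      with (cis (t + (IZR m * (2 * c) - IZR n * (2 * b)))).
    replace (t + (IZR m * (2 * c) - IZR n * (2 * b))) with (2 * phase_at b c y0 (m, n) + PI)
      by (unfold phase_at, y0; cbn [fst snd]; field).
    unfold cis. rewrite neg_cos, neg_sin. unfold Cminus, Cplus, Copp, RtoC; cbn [fst snd]. f_equal; ring. }
  assert (HD : forall m n, D ((m + 1)%Z, n) = D (m, n) /\ D (m, (n + 1)%Z) = D (m, n)).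
  { intros m n. destruct (Hpsi m n) as [H1 H2].
    apply (f_equal toC) in H1. apply (f_equal toC) in H2.
    rewrite toC_sub, toC_mul, Heta in H1, H2. rewrite toC_DeltaB in H2.
    change (toC DeltaA) with (RtoC 1) in H1.
    assert (E1 : zeta b c y0 ((m + 1)%Z, n) = (zeta b c y0 (m, n)
               + (1 - cis (2 * c)) * (1 - cis (2 * phase_at b c y0 (m, n))))%C).
    { replace ((m + 1)%Z, n) with ((m + 1)%Z, (n + 0)%Z) by (f_equal; lia). rewrite zeta_shift.
      replace (2 * (phase_at b c y0 (m, n) + 1 * c - 0 * b))
        with (2 * phase_at b c y0 (m, n) + 2 * c) by ring.
      rewrite cis_plus. ring. }
    assert (E2 : zeta b c y0 (m, (n + 1)%Z) = (zeta b c y0 (m, n)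
               + (1 - cis (- (2 * b))) * (1 - cis (2 * phase_at b c y0 (m, n))))%C).
    { replace (m, (n + 1)%Z) with ((m + 0)%Z, (n + 1)%Z) by (f_equal; lia). rewrite zeta_shift.
      replace (2 * (phase_at b c y0 (m, n) + 0 * c - 1 * b))
        with (2 * phase_at b c y0 (m, n) + - (2 * b)) by ring.
      rewrite cis_plus. ring. }
    unfold D, kappa. rewrite E1, E2. split.
    - transitivity (toC (psi ((m + 1)%Z, n)) - toC (psi (m, n)) + toC (psi (m, n))
        - / (1 - cis (2 * c)) * zeta b c y0 (m, n) - (1 - cis (2 * phase_at b c y0 (m, n))))%C;
        [field; auto|]. rewrite H1. ring.
    - transitivity (toC (psi (m, (n + 1)%Z)) - toC (psi (m, n)) + toC (psi (m, n))
        - / (1 - cis (2 * c)) * zeta b c y0 (m, n)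
        - (1 - cis (- (2 * b))) / (1 - cis (2 * c)) * (1 - cis (2 * phase_at b c y0 (m, n))))%C;
        [field; auto|]. rewrite H2. field. auto. }
  assert (Hconst : forall m n, D (m, n) = D (0%Z, 0%Z)).
  { intros m n. transitivity (D (m, 0%Z)).
    - induction n using Z.peano_ind; [reflexivity| |].
      + unfold Z.succ. rewrite (proj2 (HD m n)). exact IHn.
      + rewrite <- IHn, <- (proj2 (HD m (Z.pred n))). f_equal. f_equal. lia.
    - induction m using Z.peano_ind; [reflexivity| |].
      + unfold Z.succ. rewrite (proj1 (HD m 0%Z)). exact IHm.
      + rewrite <- IHm, <- (proj1 (HD (Z.pred m) 0%Z)). f_equal. f_equal. lia. }
  exists y0, (D (0%Z, 0%Z)), kappa. split.
  - intros E. apply C1_nz. transitivity ((1 - cis (2 * c)) * kappa)%C.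
    + unfold kappa. field. exact Hn.
    + rewrite E. ring.
  - intros [m n]. rewrite <- (Hconst m n). unfold D. ring.
Qed.

End Angles.

Theorem mainTheorem6 (pa pb pc : R) (lam : Cx) (psi : V -> Cx) :
  0 < pa < 1 -> 0 < pb < 1 -> 0 < pc < 1 -> pa + pb + pc = 1 ->
  Cabs lam = 1 ->
  is_psi pa pb pc lam psi ->
  nondegenerate psi ->
  recurrent psi.
Proof.
  intros Hpa Hpb Hpc Hsum Hlam Hpsi Hnd.
  destruct (psi_affine_zeta pa pb pc Hpa Hpb Hpc Hsum lam psi Hlam Hpsi) as (y0 & k0 & kappa & Hk & E).
  destruct (angles_pos pa pb pc Hpa Hpb Hpc) as (Ha & Hb & Hc).
  exact (walk_recurrent _ _ _ y0 Ha Hb Hc (angles_sum pa pb pc Hsum) psi k0 kappa Hk E Hnd).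
Qed.
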